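(* Let $0\le k\le n$ be integers. The bijection $\langle u,w\rangle\mapsto f_{u,w}=u\,t_{\omega_k}w^{-1}$ is a poset isomorphism from $(\mathcal{Q}(k,n),\le)$ to the poset of bounded affine permutations $(\mathrm{Bound}(k,n),\le)$. Furthermore, $\ell(f_{u,w})=k(n-k)-\ell(w)+\ell(u)$.
   Context: Permutations in $S_n$ are multiplied by $(uw)(i)=u(w(i))$; $\ell$ on $S_n$ is the number of inversions; $\le$ on $S_n$ is (strong) Bruhat order with covers $\lessdot$; $[u,w]$ denotes a Bruhat interval. **$\mathcal{Q}(k,n)$.** Put $\sigma_k(w)=w(\{1,\dots,k\})$. Say $u$ $k$-covers $w$ if $u\gtrdot w$ and $\sigma_k(u)\neq\sigma_k(w)$; the $k$-Bruhat order $\le_k$ is the partial order generated by these covers; $[u,w]_k$ is the interval in $\le_k$. $\mathcal{Q}(k,n)$ is the set of equivalence classes $\langle u,w\rangle$ of $k$-Bruhat intervals $[u,w]_k$ ($u\le_k w$) under the relation generated by $[u,w]_k\sim[uz,wz]_k$ whenever $z\in S_k\times S_{n-k}$ and $\ell(uz)=\ell(u)+\ell(z)$, $\ell(wz)=\ell(w)+\ell(z)$. Partial order: $q\le q'$ in $\mathcal{Q}(k,n)$ if and only if there are representatives $[u,w]_k\in q$ and $[u',w']_k\in q'$ with $[u',w']\subseteq[u,w]$. **$\mathrm{Bound}(k,n)$.** Let $\tilde{S}_n$ be the group of bijections $f:\mathbb{Z}\to\mathbb{Z}$ with $f(i+n)=f(i)+n$ for all $i$ (affine permutations); $\tilde{S}_n^k$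 is the subset with $\frac1n\sum_{i=1}^n(f(i)-i)=k$. $\tilde{S}_n^0$ is the affine symmetric group, a Coxeter group with simple generators $s_0,\dots,s_{n-1}$, where $s_i$ interchanges $i+rn$ and $i+1+rn$ for all $r$; it carries its Bruhat order, transported to $\tilde{S}_n^k$ by the bijection $\tilde{S}_n^0\to\tilde{S}_n^k$, $f\mapsto f\circ(i\mapsto i+k)$. The length $\ell(f)$ of $f\in\tilde{S}_n$ is the number of pairs $(i,j)$ with $i<j$, $f(i)>f(j)$, modulo simultaneous translation by multiples of $n$. $\mathrm{Bound}(k,n)=\{f\in\tilde{S}_n^k: i\le f(i)\le i+n\ \forall i\}$ with the restricted Bruhat order. $S_n$ embeds in $\tilde{S}_n$ by periodic extension; $t_{\omega_k}\in\tilde{S}_n^k$ is given by $t_{\omega_k}(i)=i+n$ for $1\le i\le k$, $t_{\omega_k}(i)=i$ for $k<i\le n$. *)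

(* Defs.v *)
From Stdlib Require Relation_Operators.
From mathcomp Require Import all_boot all_order all_algebra all_fingroup.
From mathcomp Require Import boolp classical_sets functions cardinality.

Set Implicit Arguments.
Unset Strict Implicit.
Unset Printing Implicit Defensive.

Import Order.TTheory GRing.Theory Num.Theory.

(** * Finite permutations and [Q(k,n)]

    The ordinal [j : 'I_n] stands for the letter [j + 1] of [{1, ..., n}]. *)

Section FinitePermutations.
Variables n k : nat.
Implicit Types u w z v : 'S_n.

(* MathComp's product of permutations is [(s * t) i = t (s i)]; this is the
   product [(u w)(i) = u (w i)]. *)
Definition pmul u w : 'S_n := (w * u)%g.

Definition plength u : nat :=
  #|[set p : 'I_n * 'I_n | (p.1 < p.2) && (u p.2 < u p.1)]|.

Definition bruhat_step u w : bool :=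
  [exists i : 'I_n, exists j : 'I_n,
     [&& i != j, w == pmul u (tperm i j) & plength u < plength w]].

Definition bruhat_le : rel 'S_n := connect bruhat_step.

Definition bruhat_cover u w : bool :=
  [&& bruhat_le u w, u != w &
      [forall v, bruhat_le u v && bruhat_le v w ==> (v == u) || (v == w)]].

Definition bruhat_interval u w : {set 'S_n} :=
  [set v | bruhat_le u v && bruhat_le v w].

Definition sigma w : {set 'I_n} := [set w i | i : 'I_n & i < k].

Definition k_cover u w : bool := bruhat_cover u w && (sigma w != sigma u).

Definition k_bruhat_le : rel 'S_n := connect k_cover.

Definition in_young z : bool := [forall i : 'I_n, (z i < k) == (i < k)].

(* The k-Bruhat interval [u, w]_k is encoded by the pair [(u, w)] of its
   endpoints, with [k_bruhat_le u w]. *)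
Definition Q_step (p q : 'S_n * 'S_n) : bool :=
  [&& k_bruhat_le p.1 p.2, k_bruhat_le q.1 q.2 &
    [exists z, [&& in_young z,
       q.1 == pmul p.1 z, q.2 == pmul p.2 z,
       plength q.1 == plength p.1 + plength z &
       plength q.2 == plength p.2 + plength z]]].

Definition Q_equiv : rel ('S_n * 'S_n) :=
  connect (fun p q => Q_step p q || Q_step q p).

Definition Q_class u w : {set 'S_n * 'S_n} := [set p | Q_equiv (u, w) p].

Definition Q_poset : {set {set 'S_n * 'S_n}} :=
  [set Q_class p.1 p.2 | p : 'S_n * 'S_n & k_bruhat_le p.1 p.2].

Definition Q_le (q q' : {set 'S_n * 'S_n}) : bool :=
  [exists p in q, exists p' in q',
     bruhat_interval p'.1 p'.2 \subset bruhat_interval p.1 p.2].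

End FinitePermutations.

(** * Affine permutations *)

Section AffinePermutations.
Local Open Scope ring_scope.
Variables n k : nat.
Implicit Types f g s t : int -> int.

Definition is_affine f : Prop :=
  bijective f /\ forall i, f (i + n%:Z) = f i + n%:Z.

(* The average displacement is [d], with the denominator [n] cleared. *)
Definition is_affine_deg (d : nat) f : Prop :=
  is_affine f /\ \sum_(1 <= i < n.+1) (f i%:Z - i%:Z) = (n * d)%:Z.

(* [s] is one of [s_0, ..., s_{n-1}].  For [n = 1] the two prescribed values
   conflict, so there are no generators, as befits the trivial group. *)
Definition is_simple s : Prop :=
  exists i : 'I_n,
    (forall r : int, s (i%:Z + r * n%:Z) = i%:Z + 1 + r * n%:Z /\
                     s (i%:Z + 1 + r * n%:Z) = i%:Z + r * n%:Z) /\
    (forall j : int, (forall r : int, j <> i%:Z + r * n%:Z /\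
                                      j <> i%:Z + 1 + r * n%:Z) -> s j = j).

Fixpoint is_simple_product (m : nat) f : Prop :=
  if m is m'.+1 then
    exists s g, [/\ is_simple s, is_simple_product m' g & f = s \o g]
  else f = id.

Definition coxeter_length f (m : nat) : Prop :=
  is_simple_product m f /\
  forall m', is_simple_product m' f -> (m <= m')%N.

Definition is_reflection t : Prop :=
  exists s a b, [/\ is_simple s, is_affine_deg 0 a, cancel a b, cancel b a &
                    t = a \o s \o b].

Definition coxeter_step f g : Prop :=
  exists t a b, [/\ is_reflection t, g = f \o t,
                    coxeter_length f a, coxeter_length g b & (a < b)%N].

Definition coxeter_bruhat_le : (int -> int) -> (int -> int) -> Prop :=
  Relation_Operators.clos_refl_trans _ coxeter_step.

(* Bruhat order on the component of degree [k], transported along the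
   bijection [f |-> f \o (fun i => i + k)] from the component of degree 0. *)
Definition affine_bruhat_le f g : Prop :=
  coxeter_bruhat_le (fun i => f (i - k%:Z)) (fun i => g (i - k%:Z)).

Definition Bound : set (int -> int) := fun f =>
  is_affine_deg k f /\ forall i : int, i <= f i <= i + n%:Z.

Definition translates (p : int * int) : set (int * int) := fun q =>
  exists r : int, q = (p.1 + r * n%:Z, p.2 + r * n%:Z).

Definition affine_inversions f : set (set (int * int)) := fun c =>
  exists i j : int, [/\ i < j, f j < f i & c = translates (i, j)].

Definition affine_length f (m : nat) : Prop :=
  (affine_inversions f #= `I_m)%card.

(* Periodic extension: [i = (j + 1) + q n] with [0 <= j < n] goes to
   [(u j + 1) + q n].  The [else] branch is reached only when [n = 0]. *)
Definition periodic (u : 'S_n) : int -> int := fun i =>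
  if insub `|((i - 1) %% n%:Z)%Z|%N is Some j
  then (u j).+1%:Z + ((i - 1) %/ n%:Z)%Z * n%:Z else i.

Definition t_omega : int -> int := fun i =>
  if ((i - 1) %% n%:Z)%Z < k%:Z then i + n%:Z else i.

Definition f_uw (u w : 'S_n) : int -> int :=
  periodic u \o t_omega \o periodic (w^-1)%g.

End AffinePermutations.

(** * Isomorphisms of posets carried by sets *)

Definition partial_order_on (T : Type) (A : set T) (le : T -> T -> Prop) :=
  [/\ forall x, A x -> le x x,
      forall x y, A x -> A y -> le x y -> le y x -> x = y &
      forall x y z, A x -> A y -> A z -> le x y -> le y z -> le x z].

Definition poset_iso (T U : Type) (A : set T) (leA : T -> T -> Prop)
    (B : set U) (leB : U -> U -> Prop) (F : T -> U) : Prop :=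
  [/\ partial_order_on A leA, partial_order_on B leB, set_bij A B F &
      forall x y, A x -> A y -> (leA x y <-> leB (F x) (F y))].

(* Main.v *)
Require Import Defs.
From mathcomp Require Import all_boot all_order all_algebra all_fingroup.
From mathcomp Require Import boolp classical_sets functions cardinality.
From mathcomp Require Import zify.

(** The element f = u t_omega w^-1 forgets exactly the choice of a
    representative: t_omega commutes with S_k x S_(n-k), so translating u and w
    on the right by the same z of this Young subgroup does not change f, and
    conversely f determines (u, w) up to such a z ([f_uw_inj]).

    _Which pairs occur._  By a theorem of Bergeron and Sottile, u is below w in
    the k-Bruhat order iff u <= w on the first k positions, u >= w on the other
    positions, and each ascent of u inside one of these two blocks of positions
    is also an ascent of w ([k_bruhatP]).  The first two conditions say exactly
    that i <= f(i) <= i + n ([f_uw_BoundP]).  The third one is automatic if w is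
    increasing on both blocks, or if u is decreasing on both.  A bounded f is
    thus attained by a pair with w increasing on the blocks ([Bound_exists]),
    and simple moves bring every interval to the one such representative of its
    class ([related_Q_equiv]).

    _Both Bruhat orders in terms of swaps._  For p < q, swapping the values of f
    at p and q (and at their translates) goes up iff f(p) < f(q).  Twice the
    length is a sum over ordered pairs of indices of the distance between two
    numbers, one given by the positions and one by the values; a swap changes
    it as in the rearrangement inequality |A - F| + |B - G| <= |A - G| + |B - F|
    for A <= B and F <= G ([disc_swap_lt]).  In the finite case the two numbers
    are signs of differences, in the affine case they are the floors of
    (a - b) / n and (f(a) - f(b)) / n, a symmetric form of Shi's length formula
    ([coxeter_lengthP]).

    _From intervals to affine permutations._  By the lifting property, a
    containment [u', w'] c [u, w] can be carried along when the larger interval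
    is translated ([nested_transport]), so w may be taken increasing on blocks.
    Then each step from u up to u' raises f ([f_uw_mono_left]).  After a further
    translation u' is decreasing on blocks, and each step from w down to w'
    raises f ([f_uw_anti_right]).

    _Back to intervals._  Bounded elements form a lower set ([affine_up_Bound]),
    so a chain of swaps below a bounded element stays bounded, and it suffices
    to undo one swap, of p < q say.  Boundedness forces q - p < n.  If p and q
    lie in the same translate of {1, ..., n}, the swap enlarges the interval at
    the top, starting from a representative with u' decreasing on blocks;
    otherwise it enlarges the interval at the bottom, starting from one with w'
    increasing on blocks ([affine_up_nested]).

    _Length._  An inversion class of a bounded f is an ordered pair of positions
    of u and w, and the conditions of Bergeron and Sottile turn the number of
    these pairs into k (n - k) - l(w) + l(u) pair by pair
    ([sum_inversion_pair]). *)

Set Implicit Arguments.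
Unset Strict Implicit.
Unset Printing Implicit Defensive.

Import Order.TTheory GRing.Theory Num.Theory.

(** * Swapping two indices in a double sum of distances *)

Section Discrepancy.
Local Open Scope ring_scope.
Variable T : finType.
Implicit Types (A F : T -> T -> int) (p q a b c : T).

(** Twice the length of a permutation, finite or affine, has this form: A
    compares positions and F compares values. *)
Definition disc A F : nat :=
  (\sum_(x : T * T) `|A x.1 x.2 - F x.1 x.2|)%N.

(** The shape of (a, b) |-> floor((x_a - x_b) / n) for numbers x_a that are
    pairwise incongruent modulo n. *)
Definition floor_like A : Prop :=
  (forall a, A a a = 0) /\ (forall a b, a != b -> A a b + A b a = -1).

Definition swapped F p q a b : int := F (tperm p q a) (tperm p q b).

(** Doubling the sum makes it possible to compare the terms at (a, b) and at the
    swapped pair together, which is where the rearrangement inequality applies. *)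
Lemma disc_reindex A F p q :
  ((disc A F).*2 = \sum_(x : T * T)
    (`|A x.1 x.2 - F x.1 x.2| +
     `|A (tperm p q x.1) (tperm p q x.2) - swapped F p q x.1 x.2|))%N.
Proof.
rewrite big_split /= -addnn; congr addn.
rewrite /disc (reindex (fun x : T * T => (tperm p q x.1, tperm p q x.2))) //=.
by exists (fun x : T * T => (tperm p q x.1, tperm p q x.2)) => -[a b] _ /=;
  rewrite !tpermK.
Qed.

(** Off p and q nothing changes; for a pair with one index in {p, q} this is the
    rearrangement inequality, and at (p, q) and (q, p) the gain is strict. *)
Lemma disc_swap_pointwise A F p q a b :
    p != q -> floor_like A -> floor_like F -> 0 <= A q p -> 0 <= F q p ->
    (forall c, c != p -> c != q -> A p c <= A q c /\ F p c <= F q c) ->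
  (`|A a b - F a b| +
   `|A (tperm p q a) (tperm p q b) - swapped F p q a b| +
   ((a == p) && (b == q) + (a == q) && (b == p)).*2 <=
   `|A a b - swapped F p q a b| +
   `|A (tperm p q a) (tperm p q b) - F a b|)%N.
Proof.
move=> npq [A0 AN] [F0 FN] Aqp Fqp mono; rewrite /swapped.
have Apq := AN _ _ npq; have Fpq := FN _ _ npq.
have nqp : q != p by rewrite eq_sym.
case: (tpermP p q a) => [->|->|/eqP ap /eqP aq];
  case: (tpermP p q b) => [->|->|/eqP bp /eqP bq];
  rewrite ?eqxx ?A0 ?F0 ?(negbTE npq) ?(negbTE nqp)
    ?(negbTE ap) ?(negbTE aq) ?(negbTE bp) ?(negbTE bq) /=; try lia.
- by have [] := mono _ bp bq; lia.
- by have [] := mono _ bp bq; lia.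
- by have := AN _ _ ap; have := AN _ _ aq; have := FN _ _ ap;
    have := FN _ _ aq; have [] := mono _ ap aq; lia.
- by have := AN _ _ ap; have := AN _ _ aq; have := FN _ _ ap;
    have := FN _ _ aq; have [] := mono _ ap aq; lia.
Qed.

(** The rearrangement inequality is an equality when two of the numbers to be
    rearranged coincide: no index separates p from q both in A and in F. *)
Lemma disc_swap_pointwise_eq A F p q a b :
    p != q -> floor_like A -> floor_like F -> A q p = 0 -> 0 <= F q p ->
    (forall c, c != p -> c != q -> A p c = A q c \/ F p c = F q c) ->
  (`|A a b - F a b| +
   `|A (tperm p q a) (tperm p q b) - swapped F p q a b| +
   ((a == p) && (b == q) + (a == q) && (b == p)).*2 =
   `|A a b - swapped F p q a b| +
   `|A (tperm p q a) (tperm p q b) - F a b|)%N.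
Proof.
move=> npq [A0 AN] [F0 FN] Aqp Fqp mono; rewrite /swapped.
have Apq := AN _ _ npq; have Fpq := FN _ _ npq.
have nqp : q != p by rewrite eq_sym.
case: (tpermP p q a) => [->|->|/eqP ap /eqP aq];
  case: (tpermP p q b) => [->|->|/eqP bp /eqP bq];
  rewrite ?eqxx ?A0 ?F0 ?(negbTE npq) ?(negbTE nqp)
    ?(negbTE ap) ?(negbTE aq) ?(negbTE bp) ?(negbTE bq) /=; try lia.
- by have [] := mono _ bp bq; lia.
- by have [] := mono _ bp bq; lia.
- by have := AN _ _ ap; have := AN _ _ aq; have := FN _ _ ap;
    have := FN _ _ aq; have [] := mono _ ap aq; lia.
- by have := AN _ _ ap; have := AN _ _ aq; have := FN _ _ ap;
    have := FN _ _ aq; have [] := mono _ ap aq; lia.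
Qed.

Lemma sum_pair_ends p q : (\sum_(x : T * T)
  ((x.1 == p) && (x.2 == q) + (x.1 == q) && (x.2 == p)).*2 = 4)%N.
Proof.
have one a b : (\sum_(x : T * T) ((x.1 == a) && (x.2 == b)) = 1)%N.
  rewrite (bigD1 (a, b)) //= !eqxx big1 // => -[c d]; rewrite xpair_eqE /=.
  by case: (_ && _).
rewrite (eq_bigr (fun x : T * T => (x.1 == p) && (x.2 == q) +
  (x.1 == q) && (x.2 == p) + ((x.1 == p) && (x.2 == q) +
  (x.1 == q) && (x.2 == p)))%N); last by move=> x _; rewrite addnn.
by rewrite !big_split /= !one.
Qed.

Lemma disc_swap_reindex A F p q :
  ((disc A (swapped F p q)).*2 = \sum_(x : T * T)
    (`|A x.1 x.2 - swapped F p q x.1 x.2| +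
     `|A (tperm p q x.1) (tperm p q x.2) - F x.1 x.2|))%N.
Proof.
rewrite (disc_reindex _ _ p q); apply: eq_bigr => x _.
by rewrite /swapped !tpermK.
Qed.

Lemma disc_swap_lt A F p q :
    p != q -> floor_like A -> floor_like F -> 0 <= A q p -> 0 <= F q p ->
    (forall c, c != p -> c != q -> A p c <= A q c /\ F p c <= F q c) ->
  (disc A F < disc A (swapped F p q))%N.
Proof.
move=> npq sA sF Aqp Fqp mono.
suff : ((disc A F).*2 + 4 <= (disc A (swapped F p q)).*2)%N by lia.
rewrite -(sum_pair_ends p q) (disc_reindex _ _ p q) disc_swap_reindex.
rewrite -big_split /=; apply: leq_sum => x _.
exact: disc_swap_pointwise.
Qed.

Lemma disc_swap_add2 A F p q :
    p != q -> floor_like A -> floor_like F -> A q p = 0 -> 0 <= F q p ->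
    (forall c, c != p -> c != q -> A p c = A q c \/ F p c = F q c) ->
  disc A (swapped F p q) = (disc A F).+2.
Proof.
move=> npq sA sF Aqp Fqp mono.
suff : ((disc A F).*2 + 4 = (disc A (swapped F p q)).*2)%N by lia.
rewrite -(sum_pair_ends p q) (disc_reindex _ _ p q) disc_swap_reindex.
rewrite -big_split /=; apply: eq_bigr => x _.
exact: disc_swap_pointwise_eq.
Qed.

End Discrepancy.

(** * Inversions and Bruhat order of a finite permutation *)

Section FiniteBruhat.
Variable n : nat.
Implicit Types (u v w x y z : 'S_n) (i j l a b c : 'I_n).

Lemma pmulE u w a : pmul u w a = u (w a).
Proof. exact: permM. Qed.

Lemma pmulA u v w : pmul u (pmul v w) = pmul (pmul u v) w.
Proof. by rewrite /pmul mulgA. Qed.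

Lemma pmul_tpermK i j u : pmul (pmul u (tperm i j)) (tperm i j) = u.
Proof. by apply/permP => a; rewrite !pmulE tpermK. Qed.

Lemma perm_neq u a b : a != b -> u a != u b.
Proof. by rewrite (inj_eq perm_inj). Qed.

Lemma perm_lt_neq u a b : a < b -> u a <> u b :> nat.
Proof. by move=> ab /val_inj /perm_inj eq_ab; move: ab; rewrite eq_ab ltnn. Qed.

(** This is floor((u a - u b) / n), as |u a - u b| < n. *)
Definition perm_floor u a b : int := (- (u a < u b)%:Z)%R.

Lemma perm_floor_like u : floor_like (perm_floor u).
Proof.
split=> [a|a b /(perm_neq u)]; rewrite /perm_floor ?ltnn //.
by rewrite -(inj_eq val_inj) /=; lia.
Qed.

(** A term is 1 when the pair is an inversion, and an inversion is seen by both
    of its orderings. *)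
Lemma disc_perm_floor u :
  disc (perm_floor 1%g) (perm_floor u) = (plength u).*2.
Proof.
pose inv (x : 'I_n * 'I_n) : nat := (x.1 < x.2) && (u x.2 < u x.1).
have sum_inv : \sum_x inv x = plength u.
  rewrite /plength -sum1_card [RHS]big_mkcond; apply: eq_bigr => x _ /=.
  by rewrite inE /inv; case: (_ && _).
have sum_vni : \sum_x inv (x.2, x.1) = plength u.
  rewrite -sum_inv [RHS](reindex (fun x : 'I_n * 'I_n => (x.2, x.1))) //=.
  by exists (fun x : 'I_n * 'I_n => (x.2, x.1)) => -[].
rewrite -addnn -{1}sum_inv -sum_vni -big_split /=; apply: eq_bigr => -[a b] _.
rewrite /perm_floor /inv /= !perm1.
have [->|nab] := eqVneq a b; first by rewrite !ltnn.
have := perm_neq u nab; move: nab; rewrite -!(inj_eq val_inj) /=.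
by lia.
Qed.

Lemma perm_floor_swapped u i j :
  swapped (perm_floor u) i j = perm_floor (pmul u (tperm i j)).
Proof. by apply/funext=> a; apply/funext=> b; rewrite /perm_floor !pmulE. Qed.

Lemma plength_swap_lt u i j : i < j -> u i < u j ->
  plength u < plength (pmul u (tperm i j)).
Proof.
move=> ij uij; suff: (plength u).*2 < (plength (pmul u (tperm i j))).*2 by lia.
rewrite -!disc_perm_floor -perm_floor_swapped.
apply: disc_swap_lt; rewrite ?neq_ltn ?ij //; do ?exact: perm_floor_like.
- by rewrite /perm_floor !perm1; lia.
- by rewrite /perm_floor; lia.
by move=> c _ _; rewrite /perm_floor !perm1; lia.
Qed.

Lemma plength_swap_cover u i j : i < j -> u i < u j ->
    (forall l, i < l < j -> ~~ (u i < u l < u j)) ->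
  plength (pmul u (tperm i j)) = (plength u).+1.
Proof.
move=> ij uij gap.
suff: (plength (pmul u (tperm i j))).*2 = (plength u).*2.+2 by lia.
rewrite -!disc_perm_floor -perm_floor_swapped.
apply: disc_swap_add2; rewrite ?neq_ltn ?ij //; do ?exact: perm_floor_like.
- by rewrite /perm_floor !perm1; lia.
- by rewrite /perm_floor; lia.
move=> c ci cj; rewrite /perm_floor !perm1.
have := gap c; have := perm_neq u ci; have := perm_neq u cj; move: ci cj.
by rewrite -!(inj_eq val_inj) /=; lia.
Qed.

Lemma plength_swap u i j : i < j ->
  (plength u < plength (pmul u (tperm i j))) = (u i < u j).
Proof.
move=> ij; apply/idP/idP => [|uij]; last exact: plength_swap_lt.
case: (ltngtP (u i) (u j)) (@perm_lt_neq u _ _ ij) => // uji _ len_lt.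
have := @plength_swap_lt (pmul u (tperm i j)) i j ij.
by rewrite !pmulE tpermL tpermR pmul_tpermK => /(_ uji); lia.
Qed.

Lemma bruhat_stepP u w :
  reflect (exists i j, [/\ i < j, u i < u j & w = pmul u (tperm i j)])
          (bruhat_step u w).
Proof.
apply: (iffP existsP) => [[i /existsP[j]]|[i [j [ij uij ->]]]]; last first.
  exists i; apply/existsP; exists j.
  by rewrite eqxx plength_swap_lt // neq_ltn ij.
case/and3P; rewrite -(inj_eq val_inj) neq_ltn.
case/orP => ij /eqP->; last rewrite tpermC; rewrite plength_swap // => uij.
  by exists i, j.
by exists j, i.
Qed.

Lemma bruhat_refl u : bruhat_le u u.
Proof. exact: connect0. Qed.

Lemma bruhat_trans v u w : bruhat_le u v -> bruhat_le v w -> bruhat_le u w.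
Proof. exact: connect_trans. Qed.

Lemma bruhat_swap u i j : i < j -> u i < u j ->
  bruhat_le u (pmul u (tperm i j)).
Proof. by move=> ij uij; apply/connect1/bruhat_stepP; exists i, j. Qed.

(** Induction along a chain of swaps that each create an inversion, from the
    bottom up. *)
Lemma bruhat_le_ind (P : 'S_n -> 'S_n -> Prop) :
    (forall u, P u u) ->
    (forall u i j w, i < j -> u i < u j ->
       bruhat_le (pmul u (tperm i j)) w -> P (pmul u (tperm i j)) w -> P u w) ->
  forall u w, bruhat_le u w -> P u w.
Proof.
move=> P0 PS u w /connectP[s]; elim: s u => [|v s IHs] u /=.
  by move=> _ ->.
case/andP=> /bruhat_stepP[i [j [ij uij def_v]]] pth last_w.
apply: (PS u i j) => //; rewrite -def_v; last exact: IHs.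
by apply/connectP; exists s.
Qed.

Lemma bruhat_le_plength u w : bruhat_le u w ->
  plength u <= plength w /\ (plength u = plength w -> u = w).
Proof.
elim/bruhat_le_ind: u w / => [//|u i j w ij uij _].
by have := plength_swap_lt ij uij; lia.
Qed.

(** A value between u i and u j at a position between i and j would split the
    swap of i and j into three ascending swaps (i l), (l j), (i l).  Without such
    a value the length grows by one only, which leaves no room in between. *)
Lemma bruhat_coverP u w :
  reflect (exists i j, [/\ i < j, u i < u j, w = pmul u (tperm i j) &
             forall l, i < l < j -> ~~ (u i < u l < u j)])
          (bruhat_cover u w).
Proof.
apply: (iffP and3P) => [[]|[i [j [ij uij -> gap]]]]; last first.
  have step := bruhat_swap ij uij; have len := plength_swap_cover ij uij gap.
  split=> //; first by apply/eqP=> E; move: len; rewrite -E; lia.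
  apply/forallP=> v; apply/implyP=> /andP[uv vw].
  have [uv_le uv_eq] := bruhat_le_plength uv.
  have [vw_le vw_eq] := bruhat_le_plength vw.
  have [E|E] : plength u = plength v \/
      plength v = plength (pmul u (tperm i j)) by lia.
    by rewrite (uv_eq E) eqxx.
  by rewrite (vw_eq E) eqxx orbT.
move=> uw neq /forallP no_mid; move: uw neq no_mid.
elim/bruhat_le_ind: u w /; first by move=> u; rewrite eqxx.
move=> u i j w ij uij vw _ _ no_mid.
have [def_v|def_w] : pmul u (tperm i j) = u \/ w = pmul u (tperm i j).
  have := no_mid (pmul u (tperm i j)); rewrite bruhat_swap // vw.
  by case/orP => /eqP; auto.
  by have := plength_swap_lt ij uij; rewrite def_v ltnn.
exists i, j; split=> // l /andP[il lj]; apply/negP=> /andP[uil ulj].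
pose u1 := pmul u (tperm i l); pose u2 := pmul u1 (tperm l j).
have nil : i != l by rewrite neq_ltn il.
have nlj : l != j by rewrite neq_ltn lj.
have nij : i != j by rewrite neq_ltn ij.
(* The braid relation (i j) = (i l) (l j) (i l), with ascending swaps only. *)
have step1 : bruhat_le u u1 by exact: bruhat_swap.
have u1E : (u1 i = u l) * (u1 l = u i) * (u1 j = u j).
  by rewrite /u1 !pmulE tpermL tpermR tpermD.
have step2 : bruhat_le u1 u2 by apply: bruhat_swap; rewrite ?u1E.
have u2E : (u2 i = u l) * (u2 l = u j) * (u2 j = u i).
  have u2E a : u2 a = u1 (tperm l j a) by exact: pmulE.
  by rewrite !u2E tpermL tpermR tpermD 1?eq_sym // !u1E.
have def_u2 : pmul u2 (tperm i l) = w.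
  rewrite def_w; apply/permP=> a; rewrite /u2 /u1 !pmulE; congr (u _).
  case: (tpermP i j a) => [->|->|/eqP ai /eqP aj].
  - by rewrite tpermL tpermL tpermD.
  - by rewrite (tpermD nij) // tpermR tpermR.
  have [->|al] := eqVneq a l.
    by rewrite tpermR (@tpermD _ l j i) // ?tpermL // eq_sym.
  by rewrite eq_sym in ai; rewrite eq_sym in aj; rewrite eq_sym in al;
    rewrite !tpermD.
have step3 : bruhat_le u2 w by rewrite -def_u2; apply: bruhat_swap; rewrite ?u2E.
have := no_mid u1; rewrite step1 (bruhat_trans step2 step3) /=.
case/orP=> /eqP E.
  by have := plength_swap_lt il uil; rewrite -/u1 E ltnn.
have := (bruhat_le_plength step3).1.
have : plength u1 < plength u2 by apply: plength_swap_lt; rewrite ?u1E.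
by rewrite E; lia.
Qed.

End FiniteBruhat.

(** * The pointwise form of the k-Bruhat order *)

Section KBruhat.
Variables n k : nat.
Implicit Types (u v w x y z : 'S_n) (i j l a b c : 'I_n).

Definition same_block a b : bool := (a < k) == (b < k).

Lemma in_youngP z : reflect (forall i, (z i < k) = (i < k)) (in_young k z).
Proof.
by apply: (iffP forallP) => zk i; [rewrite (eqP (zk i)) | rewrite zk].
Qed.

Lemma tperm_in_young i j : same_block i j -> in_young k (tperm i j).
Proof.
move=> /eqP ij; apply/in_youngP=> l.
by case: (tpermP i j l) => [->|->|//]; rewrite ij.
Qed.

Lemma mem_sigma w i : (w i \in sigma k w) = (i < k).
Proof.
apply/imsetP/idP => [[j jk /perm_inj->]|ik]; first by move: jk; rewrite inE.
by exists i; rewrite ?inE.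
Qed.

Lemma sigma_young w z : in_young k z -> sigma k (pmul w z) = sigma k w.
Proof.
move/in_youngP=> zk; apply/setP=> a.
have -> : a = pmul w z ((z^-1)%g ((w^-1)%g a)) by rewrite pmulE !permKV.
by rewrite mem_sigma {1}pmulE mem_sigma zk.
Qed.

(** Counting: both sides hold for as many indices as P has elements. *)
Lemma perm_pred_converse u w (P : pred 'I_n) :
  (forall c, P (u c) -> P (w c)) -> forall c, P (w c) -> P (u c).
Proof.
move=> sub c; pose U := u @^-1: [set a | P a]; pose W := w @^-1: [set a | P a].
have /setP/(_ c) : U = W.
  apply/eqP; rewrite eqEcard !card_preimset ?leqnn ?andbT; do ?exact: perm_inj.
  by apply/fintype.subsetP => a; rewrite !inE; apply: sub.
by rewrite !inE => ->.
Qed.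

Lemma perm_le_eq u w : (forall i, u i <= w i) -> u = w.
Proof.
move=> le_uw; apply/permP=> c; apply/val_inj/eqP => /=.
rewrite eqn_leq le_uw /=.
exact: (@perm_pred_converse w u (fun a => a <= u c)
  (fun d => leq_trans (le_uw d)) c).
Qed.

Definition ascents_kept u w : Prop :=
  forall a b, same_block a b -> a < b -> u a < u b -> w a < w b.

(** The criterion of Bergeron and Sottile for the k-Bruhat order. *)
Definition k_dominated u w : Prop :=
  [/\ forall i, i < k -> u i <= w i,
      forall i, k <= i -> w i <= u i & ascents_kept u w].

(** Since the swap moves one value across the boundary between the first k
    positions and the others, it changes the set of the first k values. *)
Lemma k_coverP u w :
  reflect (exists i j, [/\ i < k <= j, u i < u j, w = pmul u (tperm i j) &
             forall l, i < l < j -> ~~ (u i < u l < u j)])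
          (k_cover k u w).
Proof.
apply: (iffP andP) => [[/bruhat_coverP[i [j [ij uij -> gap]]]]|].
  move=> neq; exists i, j; split=> //.
  have [blk|/negP] := boolP (same_block i j).
    by rewrite sigma_young ?eqxx // in neq; apply: tperm_in_young.
  by rewrite /same_block; lia.
case=> i [j [/andP[ik kj] uij -> gap]]; split.
  by apply/bruhat_coverP; exists i, j; rewrite (leq_trans ik).
apply/eqP => /setP/(_ (u j)); rewrite mem_sigma.
have -> : u j = pmul u (tperm i j) i by rewrite pmulE tpermL.
by rewrite mem_sigma ik ltnNge kj.
Qed.

(** An ascent of v at position i or j could only be lost to a value between v i
    and v j at a position between i and j, and a cover has none. *)
Lemma k_dominated_cover u v w :
  k_dominated u v -> k_cover k v w -> k_dominated u w.
Proof.
case=> up down ord /k_coverP[i [j [/andP[ik kj] vij -> gap]]].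
have ij : i < j by exact: leq_trans ik kj.
split=> [c ck|c kc|a b blk ab uab]; rewrite !pmulE.
- by have := up c ck; case: (tpermP i j c) => [|| _ _ //] ?; subst; lia.
- by have := down c kc; case: (tpermP i j c) => [|| _ _ //] ?; subst; lia.
have vab := ord a b blk ab uab.
case: (tpermP i j a) => [ai|aj|ai' _]; case: (tpermP i j b) => [bi|bj|_ bj'] //;
  subst; rewrite /same_block in blk; try by move: blk ab; lia.
- have : v b <> v j :> nat by move/val_inj/perm_inj.
  by have := gap b; lia.
- have : v a <> v i :> nat by move/val_inj/perm_inj.
  by have := gap a; lia.
Qed.

Lemma k_bruhat_dominated u w : k_bruhat_le k u w -> k_dominated u w.
Proof.
case/connectP=> s pth ->.
have: k_dominated u u by split.
elim: s {1 3 5}u pth => //= v' s IHs v /andP[cov pth] dom.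
exact/IHs/k_dominated_cover/cov.
Qed.

(** The greedy choice of Bergeron and Sottile: among the values of u that have
    to grow take the largest, u a; among the values above u a that have to move
    to or below u a take the smallest, u b.  Every value strictly between u a
    and u b is then either in its final place or moves down without reaching
    u a, so swapping a and b is a cover and preserves the criterion. *)
Lemma k_dominated_step u w : k_dominated u w -> u != w ->
  exists a b, [/\ a < k <= b, u a < u b <= w a,
                  k_cover k u (pmul u (tperm a b)) &
                  k_dominated (pmul u (tperm a b)) w].
Proof.
case=> up down ord neq.
(* If no value had to grow, then w <= u everywhere, so w = u. *)
have [a0 Pa0] : exists a, (a < k) && (u a < w a).
  apply/existsP; apply: contraNT neq => /existsPn none; apply/eqP/esym.
  apply: perm_le_eq => i; have := down i; have := none i.
  by case: (ltnP i k) => /= ik; lia.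
pose a := [arg max_(a > a0 | (a < k) && (u a < w a)) nat_of_ord (u a)].
have [ak ua_wa a_max] : [/\ a < k, u a < w a &
    forall c, c < k -> u c < w c -> u c <= u a].
  rewrite /a; case: arg_maxnP => // d /andP[dk ud] dmax; split=> // c ck uc.
  by apply: dmax; rewrite ck.
(* As many values of u as of w exceed u a, and w has such a value at a, where u
   has none. *)
have [b0 Pb0] : exists b, (w b <= u a < u b).
  apply/existsP; apply: contraTT ua_wa => /existsPn none; rewrite -leqNgt.
  rewrite leqNgt; apply/negP=> /(@perm_pred_converse u w (fun d => u a < d)).
  by rewrite ltnn => /(_ _)/negP[] // c uc; have := none c; lia.
pose b := [arg min_(b < b0 | w b <= u a < u b) nat_of_ord (u b)].
have [wb_ua ua_ub b_min] : [/\ w b <= u a, u a < u b &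
    forall c, w c <= u a -> u a < u c -> u b <= u c].
  rewrite /b; case: arg_minnP => // d /andP[wd ud] dmin; split=> // c wc uc.
  by apply: dmin; rewrite wc.
have kb : k <= b by rewrite leqNgt; apply/negP => /up; lia.
have ab : a < b by exact: leq_trans ak kb.
(* Otherwise w u^-1 maps the values strictly between u a and u b to
   themselves, and would reach w a a second time, from u a. *)
have ub_wa : u b <= w a.
  rewrite leqNgt; apply/negP => wa_ub.
  have := @perm_pred_converse u w (fun d => u a < d < u b) _ a.
  rewrite ltnn ua_wa wa_ub /= => H; suff: false by []; apply: H => // c uc.
  have := up c; have := down c; have := a_max c; have := b_min c.
  by case: (ltnP c k); lia.
have nca c : c != a -> u c <> u a :> nat.
  by move=> ca /val_inj/perm_inj/eqP; rewrite (negbTE ca).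
have ncb c : c != b -> u c <> u b :> nat.
  by move=> cb /val_inj/perm_inj/eqP; rewrite (negbTE cb).
exists a, b; split; rewrite ?ak ?kb ?ua_ub ?ub_wa //.
- apply/k_coverP; exists a, b; split; rewrite ?ak //.
  move=> c /andP[ac cb]; apply/negP => /andP[uac ucb].
  have := up c; have := down c; have := a_max c; have := b_min c.
  have := ord a c; have := ord c b; rewrite /same_block.
  by case: (ltnP c k); lia.
split=> [c ck|c kc|c d blk cd]; rewrite !pmulE.
- by have := up c ck; case: (tpermP a b c) => [|| _ _ //] ?; subst; lia.
- by have := down c kc; case: (tpermP a b c) => [|| _ _ //] ?; subst; lia.
have ord_cd := ord c d blk cd.
case: (tpermP a b c) => [ca|cb|/eqP ca' /eqP cb'];
  case: (tpermP a b d) => [da|db|/eqP da' /eqP db'] //;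
  rewrite /same_block in blk ord_cd; subst; try by move: blk cd; lia.
- have := up d; have := down d; have := a_max d; have := b_min d.
  by have := ncb d db'; case: (ltnP d k) blk; lia.
- have := up c; have := down c; have := a_max c; have := b_min c.
  by have := nca c ca'; case: (ltnP c k) blk; lia.
Qed.

Lemma k_bruhatP u w : k_bruhat_le k u w <-> k_dominated u w.
Proof.
split=> [|]; first exact: k_bruhat_dominated.
(* The total growth still to be made in the first block. *)
have [m] := ubnP (\sum_(i : 'I_n | i < k) (w i - u i)); elim: m u => // m IHm u.
rewrite ltnS => bound dom.
have [->|neq] := eqVneq u w; first exact: connect0.
have [a [b [/andP[ak kb] /andP[uab ubwa] cov dom']]] := k_dominated_step dom neq.
apply: (connect_trans (connect1 cov)); apply: IHm => //.
apply: leq_trans bound; rewrite (bigD1 a) //= [X in _ < X](bigD1 a) //=.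
rewrite -addSn leq_add //; first by rewrite pmulE tpermL; lia.
rewrite leq_eqVlt; apply/orP; left; apply/eqP; apply: eq_bigr => c /andP[ck ca].
rewrite pmulE tpermD // 1?eq_sym //.
by apply: contraTneq ck => ->; rewrite -leqNgt.
Qed.

End KBruhat.

(** * Translation by simple transpositions of the Young subgroup *)

Section YoungMoves.
Variables n k : nat.
Implicit Types (u v w x y z : 'S_n) (i j l a b c : 'I_n).

Section Lifting.
Variables i j : 'I_n.
Hypothesis ij : j = i.+1 :> nat.

(** A simple reflection makes only one positive root negative. *)
Lemma adjacent_tperm_lt a b : a < b -> (a != i) || (b != j) ->
  tperm i j a < tperm i j b.
Proof.
case: (tpermP i j a) => [->|->|/eqP + /eqP +];
  case: (tpermP i j b) => [->|->|/eqP + /eqP +];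
  by rewrite -?val_eqE /=; lia.
Qed.

Lemma tperm_conj_swap x a b :
  pmul (pmul x (tperm a b)) (tperm i j) =
  pmul (pmul x (tperm i j)) (tperm (tperm i j a) (tperm i j b)).
Proof.
by rewrite /pmul -tpermJ /conjg tpermV -!mulgA (mulgA (tperm i j) (tperm i j))
  tperm2 mul1g.
Qed.

(** Conjugating an ascending swap by a simple transposition gives an ascending
    swap, unless the two transpositions coincide. *)
Lemma bruhat_swap_lift x a b : a < b -> x a < x b ->
  (a = i /\ b = j) \/ bruhat_le (pmul x (tperm i j))
                       (pmul (pmul x (tperm a b)) (tperm i j)).
Proof.
move=> ab xab; have [/andP[/eqP-> /eqP->]|neq] := boolP ((a == i) && (b == j)).
  by left.
right; rewrite tperm_conj_swap; apply: bruhat_swap.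
  by apply: adjacent_tperm_lt; rewrite // -negb_and.
by rewrite !pmulE !tpermK.
Qed.

Definition raise x := if x i < x j then pmul x (tperm i j) else x.
Definition lower x := if x i < x j then x else pmul x (tperm i j).

Let ij_lt : i < j. Proof. by rewrite ij. Qed.

Lemma bruhat_descent x : x j < x i -> bruhat_le (pmul x (tperm i j)) x.
Proof.
move=> xji; rewrite -{2}(pmul_tpermK i j x); apply: bruhat_swap => //.
by rewrite !pmulE tpermL tpermR.
Qed.

Lemma bruhat_lower x :
  bruhat_le (lower x) x /\ bruhat_le (lower x) (pmul x (tperm i j)).
Proof.
rewrite /lower; case: (ltngtP (x i) (x j)) (@perm_lt_neq _ x _ _ ij_lt) => // xij _.
  by split; [exact: bruhat_refl | exact: bruhat_swap].
by split; [exact: bruhat_descent | exact: bruhat_refl].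
Qed.

Lemma bruhat_raise x :
  bruhat_le x (raise x) /\ bruhat_le (pmul x (tperm i j)) (raise x).
Proof.
rewrite /raise; case: (ltngtP (x i) (x j)) (@perm_lt_neq _ x _ _ ij_lt) => // xij _.
  by split; [exact: bruhat_swap | exact: bruhat_refl].
by split; [exact: bruhat_refl | exact: bruhat_descent].
Qed.

(** The lifting property of Bruhat order, in the form that multiplying each
    side by a simple transposition when this goes up preserves the order. *)
Lemma raise_mono x y : bruhat_le x y -> bruhat_le (raise x) (raise y).
Proof.
elim/bruhat_le_ind: x y / => [x|x a b y ab xab _]; first exact: bruhat_refl.
apply: bruhat_trans; have [up1 up2] := bruhat_raise (pmul x (tperm a b)).
have := bruhat_trans (bruhat_swap ab xab) up1.
rewrite {2}/raise; case: (x i < x j) => // _.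
case: (bruhat_swap_lift ab xab) => [[-> ->]|lift]; last first.
  exact: bruhat_trans lift up2.
exact: (bruhat_raise _).1.
Qed.

Lemma lower_mono x y : bruhat_le x y -> bruhat_le (lower x) (lower y).
Proof.
elim/bruhat_le_ind: x y / => [x|x a b y ab xab _]; first exact: bruhat_refl.
apply: bruhat_trans; have [lo1 lo2] := bruhat_lower x.
have := bruhat_trans lo1 (bruhat_swap ab xab).
rewrite {3}/lower; case: ifP => // _ _.
case: (bruhat_swap_lift ab xab) => [[-> ->]|lift]; last first.
  exact: bruhat_trans lo2 lift.
by rewrite pmul_tpermK.
Qed.

End Lifting.

Definition block_simple i j : bool := (j == i.+1 :> nat) && same_block k i j.

Lemma block_simpleE i j : block_simple i j ->
  [/\ j = i.+1 :> nat, i < j & same_block k i j].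
Proof. by case/andP=> /eqP-> blk; split. Qed.

Lemma block_simple_young i j : block_simple i j -> in_young k (tperm i j).
Proof. by case/andP=> _ /tperm_in_young. Qed.

Lemma same_block_tperm i j a b : same_block k i j ->
  same_block k (tperm i j a) (tperm i j b) = same_block k a b.
Proof. by move=> /tperm_in_young/in_youngP blk; rewrite /same_block !blk. Qed.

(** The ascents of the moved pair inside blocks are those of the old pair, apart
    from the one at the adjacent positions i, j themselves. *)
Lemma ascents_kept_move u w i j : block_simple i j -> ascents_kept k u w ->
    (u i < u j) = (w i < w j) ->
  ascents_kept k (pmul u (tperm i j)) (pmul w (tperm i j)).
Proof.
case/block_simpleE => jS ij blk asc eq_ij a b blk_ab ab; rewrite !pmulE.
have [/andP[/eqP-> /eqP->]|neq] := boolP ((a == i) && (b == j)).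
  rewrite tpermL tpermR; have := @perm_lt_neq _ u _ _ ij.
  by have := @perm_lt_neq _ w _ _ ij; lia.
apply: asc; first by rewrite same_block_tperm.
by apply: adjacent_tperm_lt; rewrite // -negb_and.
Qed.

Lemma k_dominated_move u w i j : block_simple i j -> k_dominated k u w ->
    (u i < u j) = (w i < w j) ->
  k_dominated k (pmul u (tperm i j)) (pmul w (tperm i j)).
Proof.
move=> sij [up down asc] eq_ij.
have /in_youngP yk := block_simple_young sij.
split=> [c ck|c kc|]; last exact: ascents_kept_move.
  by rewrite !pmulE up ?yk.
by rewrite !pmulE down // leqNgt yk -leqNgt.
Qed.

Lemma k_dominated_ascent u w i j : block_simple i j -> k_dominated k u w ->
  u i < u j -> w i < w j.
Proof. by case/block_simpleE => _ ij blk [_ _]; apply. Qed.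

Lemma k_dominated_raise u w i j : block_simple i j -> k_dominated k u w ->
  u i < u j -> k_dominated k (pmul u (tperm i j)) (pmul w (tperm i j)).
Proof.
move=> sij dom uij; apply: k_dominated_move => //.
by rewrite uij (k_dominated_ascent sij dom).
Qed.

Lemma k_dominated_descent u w i j : block_simple i j -> k_dominated k u w ->
  w j < w i -> u j < u i.
Proof.
move=> sij dom wji; have := k_dominated_ascent sij dom.
have [_ ij _] := block_simpleE sij.
by have := @perm_lt_neq _ u _ _ ij; lia.
Qed.

Lemma k_dominated_lower u w i j : block_simple i j -> k_dominated k u w ->
  w j < w i -> k_dominated k (pmul u (tperm i j)) (pmul w (tperm i j)).
Proof.
move=> sij dom wji; have uji := k_dominated_descent sij dom wji.
by apply: k_dominated_move => //; lia.
Qed.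

Definition block_increasing w :=
  forall a b, same_block k a b -> a < b -> w a < w b.

Definition block_decreasing u :=
  forall a b, same_block k a b -> a < b -> u b < u a.

(** A transitive relation needs to be checked on adjacent positions only. *)
Lemma block_simple_ind (P : 'I_n -> 'I_n -> Prop) :
    (forall i j, block_simple i j -> P i j) ->
    (forall a b c, P a b -> P b c -> P a c) ->
  forall a b, same_block k a b -> a < b -> P a b.
Proof.
move=> P1 Ptr a b; have [m] := ubnP b; elim: m b => // m IHm b bm blk ab.
have [bS|bS] := eqVneq (b : nat) a.+1.
  by apply: P1; rewrite /block_simple bS eqxx.
have c_lt : b.-1 < n by have := ltn_ord b; lia.
have blk' : same_block k a (Ordinal c_lt).
  by move: blk; rewrite /same_block /=; lia.
apply: (Ptr _ (Ordinal c_lt)).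
  by apply: IHm => //=; lia.
apply: P1; rewrite /block_simple /=; move: blk blk'; rewrite /same_block /=.
by lia.
Qed.

(** Sorting each of the two blocks of positions by adjacent transpositions. *)
Lemma block_increasing_ind (P : 'S_n -> Prop) :
    (forall w, block_increasing w -> P w) ->
    (forall w i j, block_simple i j -> w j < w i ->
       P (pmul w (tperm i j)) -> P w) ->
  forall w, P w.
Proof.
move=> Pinc PS w; have [m] := ubnP (plength w); elim: m w => // m IHm w wm.
have [/existsP[i /existsP[j /andP[sij wji]]]|/existsPn none] :=
  boolP [exists i, exists j, block_simple i j && (w j < w i)].
  apply: (PS w i j) => //; apply: IHm; have [_ ij _] := block_simpleE sij.
  have := @plength_swap_lt _ (pmul w (tperm i j)) i j ij.
  by rewrite !pmulE tpermL tpermR pmul_tpermK => /(_ wji); lia.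
apply: Pinc; apply: block_simple_ind => [i j sij|a b c]; last exact: ltn_trans.
have [_ ij _] := block_simpleE sij; have := @perm_lt_neq _ w _ _ ij.
by have /existsPn/(_ j) := none i; rewrite sij /=; lia.
Qed.

Lemma block_decreasing_ind (P : 'S_n -> Prop) :
    (forall u, block_decreasing u -> P u) ->
    (forall u i j, block_simple i j -> u i < u j ->
       P (pmul u (tperm i j)) -> P u) ->
  forall u, P u.
Proof.
move=> Pdec PS u; pose N := #|{: 'I_n * 'I_n}|.
have len v : plength v <= N by exact: max_card.
have [m] := ubnP (N - plength u); elim: m u => // m IHm u um.
have [/existsP[i /existsP[j /andP[sij uij]]]|/existsPn none] :=
  boolP [exists i, exists j, block_simple i j && (u i < u j)].
  apply: (PS u i j) => //; apply: IHm; have [_ ij _] := block_simpleE sij.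
  have := @plength_swap_lt _ u i j ij uij.
  by have := len (pmul u (tperm i j)); lia.
apply: Pdec; apply: block_simple_ind => [i j sij|a b c ab bc]; last first.
  exact: ltn_trans bc ab.
have [_ ij _] := block_simpleE sij; have := @perm_lt_neq _ u _ _ ij.
by have /existsPn/(_ j) := none i; rewrite sij /=; lia.
Qed.

Lemma in_young1 : in_young k (1%g : 'S_n).
Proof. by apply/in_youngP=> i; rewrite perm1. Qed.

Lemma in_youngM x y : in_young k x -> in_young k y -> in_young k (pmul x y).
Proof.
by move=> /in_youngP xk /in_youngP yk; apply/in_youngP=> i; rewrite pmulE xk yk.
Qed.

Lemma in_youngV x : in_young k x -> in_young k (x^-1)%g.
Proof.
by move=> /in_youngP xk; apply/in_youngP=> i; rewrite -[in RHS](permKV x i) xk.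
Qed.

Lemma sigma_eq_young w w' : sigma k w = sigma k w' ->
  in_young k (pmul (w^-1)%g w').
Proof.
move=> eq_sig; apply/in_youngP=> i; rewrite pmulE.
by rewrite -(mem_sigma k w) permKV eq_sig mem_sigma.
Qed.

(** The minimal coset representative is determined by the set of its first k
    values; the two sorted lists are compared at the first place where they
    differ. *)
Lemma block_increasing_inj w w' : sigma k w = sigma k w' ->
  block_increasing w -> block_increasing w' -> w = w'.
Proof.
move=> eq_sig inc inc'; set z := pmul (w^-1)%g w'.
have /in_youngP zk : in_young k z by exact: sigma_eq_young.
have wz a : w (z a) = w' a by rewrite /z pmulE permKV.
suff z_id m i : i < m -> z i = i.
  by apply/permP=> i; rewrite -wz (z_id _ _ (ltnSn i)).
elim: m i => // m IHm i; rewrite ltnS => im.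
have [zi|zi|/val_inj//] := ltngtP (z i) i.
  by have /perm_inj := IHm _ (leq_trans zi im).
pose c := (z^-1)%g i; have zc : z c = i by rewrite permKV.
have ic : i < c.
  rewrite ltnNge leq_eqVlt; apply/negP=> /orP[/eqP/val_inj ci|ci].
    by rewrite -ci zc ci ltnn in zi.
  by have zcc := IHm _ (leq_trans ci im); rewrite -zc zcc ltnn in ci.
have := inc' i c; rewrite -!wz zc /same_block -(zk c) zc eqxx ic.
move=> /(_ isT isT) lt1; have := inc i (z i); rewrite /same_block zk eqxx zi.
by move=> /(_ isT isT); lia.
Qed.

End YoungMoves.

(** * Classes of k-Bruhat intervals *)

Section YoungClasses.
Variables n k : nat.
Implicit Types (u v w x y z : 'S_n) (p q : 'S_n * 'S_n) (i j a b c : 'I_n).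

Definition young_related p q : Prop :=
  exists2 z, in_young k z & q = (pmul p.1 z, pmul p.2 z).

Lemma young_related_refl p : young_related p p.
Proof.
exists 1%g; first exact: in_young1.
by case: p => u w; rewrite /pmul !mul1g.
Qed.

Lemma young_related_sym p q : young_related p q -> young_related q p.
Proof.
case: p => u w [z zk ->] /=; exists (z^-1)%g; first exact: in_youngV.
by rewrite /pmul /= !mulKg.
Qed.

Lemma young_related_trans q p r :
  young_related p q -> young_related q r -> young_related p r.
Proof.
case=> z zk -> [z' zk' ->] /=; exists (pmul z z'); first exact: in_youngM.
by rewrite !pmulA.
Qed.

Lemma young_related_simple u w i j : block_simple k i j ->
  young_related (u, w) (pmul u (tperm i j), pmul w (tperm i j)).
Proof. by move=> /block_simple_young sij; exists (tperm i j). Qed.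

Lemma young_related_increasing_eq u w u' w' : young_related (u, w) (u', w') ->
  block_increasing k w -> block_increasing k w' -> (u', w') = (u, w).
Proof.
case=> z zk [-> def_w'] inc inc'; have E : w = w'.
  by apply: (block_increasing_inj (k := k)); rewrite // def_w' sigma_young.
suff -> : z = 1%g by rewrite -E /pmul mul1g.
by apply: (mulIg w); rewrite mul1g [RHS]E def_w'.
Qed.

Lemma plength1 : plength (1%g : 'S_n) = 0.
Proof.
by apply: eq_card0 => -[a b]; rewrite !inE !perm1 /=; lia.
Qed.

Lemma Q_equiv_sym : symmetric (@Q_equiv n k).
Proof. by apply: sym_connect_sym => p q; rewrite orbC. Qed.

(** When w has a descent at i, j so has u, hence both lengths drop by one: this
    is an elementary step of the equivalence of k-Bruhat intervals. *)
Lemma Q_equiv_lower u w i j : block_simple k i j -> k_dominated k u w ->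
  w j < w i -> Q_equiv k (u, w) (pmul u (tperm i j), pmul w (tperm i j)).
Proof.
move=> sij dom wji; have dom' := k_dominated_lower sij dom wji.
have uji := k_dominated_descent sij dom wji.
have [jS ij _] := block_simpleE sij.
have gap (v : 'S_n) (l : 'I_n) : i < l < j -> ~~ (v i < v l < v j) by lia.
have add1 v : v j < v i -> plength v = (plength (pmul v (tperm i j))).+1.
  move=> vji; rewrite -{1}(pmul_tpermK i j v).
  rewrite (plength_swap_cover ij) //; last exact: gap.
  by rewrite !pmulE tpermL tpermR.
rewrite Q_equiv_sym; apply/connect1/orP; left; apply/and3P; split=> /=.
- exact/k_bruhatP.
- exact/k_bruhatP.
apply/existsP; exists (tperm i j); rewrite !pmul_tpermK !eqxx.
rewrite block_simple_young //= (add1 u) // (add1 w) //.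
have -> : plength (tperm i j) = 1.
  have := plength_swap_cover (u := 1%g) ij.
  by rewrite !perm1 /pmul mulg1 plength1 => ->// l; rewrite ?perm1; lia.
by rewrite !addn1 !eqxx.
Qed.

Lemma Q_equiv_related p q : Q_equiv k p q -> k_bruhat_le k p.1 p.2 ->
  k_bruhat_le k q.1 q.2 /\ young_related p q.
Proof.
case/connectP=> s pth ->; elim: s p pth => [|r s IHs] p /=.
  by move=> _; split=> //; exact: young_related_refl.
case/andP=> step pth p_le.
have [r_le pr] : k_bruhat_le k r.1 r.2 /\ young_related p r.
  case/orP: step => /and3P[le1 le2 /existsP[z]].
    case/and5P=> zk /eqP r1 /eqP r2 _ _; split=> //; exists z => //.
    by rewrite -r1 -r2; case: (r).
  case/and5P=> zk /eqP r1 /eqP r2 _ _; split=> //.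
  by apply: young_related_sym; exists z => //; rewrite -r1 -r2; case: (p).
have [? rq] := IHs _ pth r_le; split=> //.
exact: young_related_trans pr rq.
Qed.

Lemma Q_equiv_increasing u w : k_dominated k u w ->
  exists x y, [/\ k_dominated k x y, block_increasing k y &
                  Q_equiv k (u, w) (x, y)].
Proof.
elim/(@block_increasing_ind n k): w u => [w inc|w i j sij wji IHw] u dom.
  by exists u, w; split=> //; exact: connect0.
have [x [y [dom' inc eq_xy]]] := IHw _ (k_dominated_lower sij dom wji).
exists x, y; split=> //; apply: connect_trans eq_xy.
exact: Q_equiv_lower.
Qed.

(** Both pairs go down, by moves that shorten their two ends together, to the
    same representative with increasing top. *)
Lemma related_Q_equiv u w u' w' : k_dominated k u w -> k_dominated k u' w' ->
  young_related (u, w) (u', w') -> Q_equiv k (u, w) (u', w').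
Proof.
move=> dom dom' rel; have [x [y [_ inc eq1]]] := Q_equiv_increasing dom.
have [x' [y' [_ inc' eq2]]] := Q_equiv_increasing dom'.
have [_ rel1] := Q_equiv_related eq1 (proj2 (k_bruhatP _ _ _) dom).
have [_ rel2] := Q_equiv_related eq2 (proj2 (k_bruhatP _ _ _) dom').
have rel3 : young_related (x, y) (x', y').
  apply: young_related_trans (young_related_sym rel1) _.
  exact: young_related_trans rel rel2.
apply: connect_trans eq1 _; rewrite -/(Q_equiv k _ _) Q_equiv_sym.
by rewrite -(young_related_increasing_eq rel3).
Qed.

(** Containment of Bruhat intervals, expressed through their ends; the two agree
    because the inner interval contains its ends. *)
Definition nested p q : Prop :=
  [/\ k_dominated k q.1 q.2, bruhat_le p.1 q.1 & bruhat_le q.2 p.2].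

(** If the simple transposition does not raise the bottom x of the inner interval,
    this interval already lies in the translated one and is left alone. *)
Lemma nested_raise u w q i j : block_simple k i j -> k_dominated k u w ->
    u i < u j -> nested (u, w) q ->
  exists2 q', nested (pmul u (tperm i j), pmul w (tperm i j)) q' &
              young_related q q'.
Proof.
case: q => x y sij dom uij [/= dom' ux yw].
have wij := k_dominated_ascent sij dom uij.
have [jS ij _] := block_simpleE sij.
have := raise_mono jS ux; have := raise_mono jS yw.
rewrite [raise i j w]/raise wij [raise i j u]/raise uij => yw' ux'.
have [xij|xij] := boolP (x i < x j).
  have yij := k_dominated_ascent sij dom' xij.
  exists (pmul x (tperm i j), pmul y (tperm i j)).
    split; first exact: k_dominated_raise.
      by move: ux'; rewrite /raise xij.
    by move: yw'; rewrite /raise yij.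
  exact: young_related_simple.
exists (x, y); last exact: young_related_refl.
split=> //=; first by move: ux'; rewrite /raise (negbTE xij).
exact: bruhat_trans (bruhat_raise jS y).1 yw'.
Qed.

Lemma nested_lower u w q i j : block_simple k i j -> k_dominated k u w ->
    w j < w i -> nested (u, w) q ->
  exists2 q', nested (pmul u (tperm i j), pmul w (tperm i j)) q' &
              young_related q q'.
Proof.
case: q => x y sij dom wji [/= dom' ux yw].
have uji := k_dominated_descent sij dom wji.
have [jS ij _] := block_simpleE sij.
have := lower_mono jS ux; have := lower_mono jS yw.
rewrite [lower i j w]/lower ltnNge (ltnW wji).
rewrite [lower i j u]/lower ltnNge (ltnW uji) /= => yw' ux'.
have [yji|yji] := boolP (y j < y i).
  have xji := k_dominated_descent sij dom' yji.
  exists (pmul x (tperm i j), pmul y (tperm i j)).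
    split; first exact: k_dominated_lower.
      by move: ux'; rewrite /lower ltnNge (ltnW xji).
    by move: yw'; rewrite /lower ltnNge (ltnW yji).
  exact: young_related_simple.
exists (x, y); last exact: young_related_refl.
have yij : y i < y j by have := @perm_lt_neq _ y _ _ ij; lia.
split=> //=; last by move: yw'; rewrite /lower yij.
exact: bruhat_trans ux' (bruhat_lower jS x).1.
Qed.

Lemma nested_to_increasing u w q : k_dominated k u w -> nested (u, w) q ->
  exists p' q', [/\ k_dominated k p'.1 p'.2, block_increasing k p'.2,
    young_related (u, w) p', nested p' q' & young_related q q'].
Proof.
elim/(@block_increasing_ind n k): w u q =>
  [w inc|w i j sij wji IHw] u q dom nest.
  by exists (u, w), q; split=> //; exact: young_related_refl.
have [q1 nest1 rel1] := nested_lower sij dom wji nest.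
have [p' [q' [dom' inc' relp nest' relq]]] :=
  IHw _ _ (k_dominated_lower sij dom wji) nest1.
exists p', q'; split=> //; last exact: young_related_trans rel1 relq.
by apply: young_related_trans relp; exact: young_related_simple.
Qed.

(** The moves that sort the top of (x, y) are undone one at a time, starting from
    its sorted representative p. *)
Lemma nested_from_increasing p x y q : k_dominated k x y ->
    block_increasing k p.2 -> young_related p (x, y) -> nested p q ->
  exists2 q', nested (x, y) q' & young_related q q'.
Proof.
move=> dom inc; elim/(@block_increasing_ind n k): y x dom =>
  [y incy|y i j sij yji IHy] x dom rel nest.
  exists q; last exact: young_related_refl.
  by case: p inc rel nest => u w inc rel; rewrite (young_related_increasing_eq rel).
have dom' := k_dominated_lower sij dom yji.
have rel' : young_related p (pmul x (tperm i j), pmul y (tperm i j)).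
  by apply: young_related_trans rel _; exact: young_related_simple.
have [q1 nest1 rel1] := IHy _ dom' rel' nest.
have xji := k_dominated_descent sij dom yji.
have xij : pmul x (tperm i j) i < pmul x (tperm i j) j.
  by rewrite !pmulE tpermL tpermR.
have [q2] := nested_raise sij dom' xij nest1; rewrite !pmul_tpermK => nest2 rel2.
by exists q2 => //; exact: young_related_trans rel1 rel2.
Qed.

(** Both representatives of the outer class pass through the one with
    increasing top. *)
Lemma nested_transport p p' q : k_dominated k p.1 p.2 ->
    k_dominated k p'.1 p'.2 -> young_related p p' -> nested p q ->
  exists2 q', nested p' q' & young_related q q'.
Proof.
case: p => u w; case: p' => x y dom dom' rel nest.
have [p1 [q1 [_ inc relp nest1 relq]]] := nested_to_increasing dom nest.
have rel1 : young_related p1 (x, y).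
  exact: young_related_trans (young_related_sym relp) rel.
have [q2 nest2 rel2] := nested_from_increasing dom' inc rel1 nest1.
by exists q2 => //; exact: young_related_trans relq rel2.
Qed.

Lemma bruhat_interval_sub u w x y : bruhat_le x y ->
  (bruhat_interval x y \subset bruhat_interval u w) =
  bruhat_le u x && bruhat_le y w.
Proof.
move=> xy; apply/fintype.subsetP/andP => [sub|[ux yw] v].
  have := sub x; have := sub y; rewrite !inE !bruhat_refl xy.
  by move=> /(_ isT)/andP[_ ->] /(_ isT)/andP[->].
rewrite !inE => /andP[xv vy].
by rewrite (bruhat_trans ux xv) (bruhat_trans vy yw).
Qed.

Lemma k_bruhat_bruhat u w : k_bruhat_le k u w -> bruhat_le u w.
Proof.
case/connectP=> s pth ->; elim: s u pth => [|v s IHs] u /=.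
  by rewrite bruhat_refl.
by case/andP=> /andP[/and3P[uv _ _] _] /IHs; apply: bruhat_trans.
Qed.

Lemma Q_class_memP u w p : k_dominated k u w ->
  reflect (k_dominated k p.1 p.2 /\ young_related (u, w) p) (p \in Q_class k u w).
Proof.
move=> dom; rewrite inE; apply: (iffP idP) => [eq_p|[dom' rel]].
  have [] := Q_equiv_related eq_p; first exact/k_bruhatP.
  by move/k_bruhatP.
by move: dom' rel; case: p => x y /=; exact: related_Q_equiv.
Qed.

(** The representative of the larger interval in the definition of the order may
    be prescribed, which is what makes the relation transitive. *)
Lemma Q_leP u w u' w' : k_dominated k u w -> k_dominated k u' w' ->
  Q_le (Q_class k u w) (Q_class k u' w') <->
  exists2 q, nested (u, w) q & young_related (u', w') q.
Proof.
move=> dom dom'; split=> [/existsP[p /andP[pin /existsP[q /andP[qin sub]]]]|].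
  have /Q_class_memP [//|domp relp] := pin.
  have /Q_class_memP [//|domq relq] := qin.
  have q_le : bruhat_le q.1 q.2 by apply/k_bruhat_bruhat/k_bruhatP.
  move: sub; rewrite bruhat_interval_sub // => /andP[pq qp].
  have [//|q' nest rel] := @nested_transport p (u, w) q domp dom
    (young_related_sym relp).
  by exists q' => //; exact: young_related_trans relq rel.
case=> q [domq uq qw] rel; apply/existsP; exists (u, w).
apply/andP; split.
  by apply/Q_class_memP => //; split=> //; exact: young_related_refl.
apply/existsP; exists q; apply/andP; split; first exact/(Q_class_memP _ dom').
rewrite bruhat_interval_sub; first exact/andP.
exact/k_bruhat_bruhat/k_bruhatP.
Qed.

End YoungClasses.

(** * Affine permutations, their swaps and Coxeter length *)

Section Affine.
Local Open Scope ring_scope.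
Variable n : nat.
Hypothesis n_gt0 : (0 < n)%N.
Implicit Types (f g h s t : int -> int) (x y p q m : int) (a b c : 'I_n).

Local Notation N := (n%:Z).

Definition congr_mod x y : bool := (N %| x - y)%Z.

Lemma congr_modP x y : reflect (exists m, x = y + m * N) (congr_mod x y).
Proof.
apply: (iffP dvdzP) => -[m E]; exists m; first by rewrite -E addrC subrK.
by rewrite E addrC addKr.
Qed.

Lemma congr_refl x : congr_mod x x.
Proof. by apply/congr_modP; exists 0; rewrite mul0r addr0. Qed.

Lemma congr_sym x y : congr_mod x y = congr_mod y x.
Proof. by rewrite /congr_mod -opprB rpredN. Qed.

Lemma congr_trans y x z : congr_mod x y -> congr_mod y z -> congr_mod x z.
Proof.
by move=> xy yz; rewrite /congr_mod -(subrK y x) -addrA rpredD.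
Qed.

Lemma congr_transl y x z : congr_mod x y -> congr_mod x z = congr_mod y z.
Proof.
move=> xy; apply/idP/idP; last exact: congr_trans.
by apply: congr_trans; rewrite congr_sym.
Qed.

Lemma congr_shift x y m : congr_mod (x + m * N) y = congr_mod x y.
Proof. by apply: congr_transl; apply/congr_modP; exists m. Qed.

Lemma congr_close x y : congr_mod x y -> `|x - y| < N -> x = y.
Proof.
case/congr_modP=> m ->.
rewrite [y + _]addrC addrK normrM [X in _ * X]ger0_norm // => lt_m.
suff -> : m = 0 by lia.
have [m1|//] : 1 <= `|m| \/ m = 0 by lia.
by have := n_gt0; nia.
Qed.

Lemma floor_bounds x : (x %/ N)%Z * N <= x < (x %/ N)%Z * N + N.
Proof.
have := divz_eq x N; have := @modz_ge0 x N; have := ltz_pmod x (n_gt0 : 0 < N).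
by lia.
Qed.

Lemma floor_unique x m : m * N <= x < m * N + N -> (x %/ N)%Z = m.
Proof. by have := floor_bounds x; nia. Qed.

Lemma floor_shift x m : ((x + m * N) %/ N)%Z = (x %/ N)%Z + m.
Proof. by apply: floor_unique; have := floor_bounds x; lia. Qed.

Lemma floor_mono x y : x <= y -> (x %/ N)%Z <= (y %/ N)%Z.
Proof. by have := floor_bounds x; have := floor_bounds y; nia. Qed.

Lemma floor_ge0 x : 0 <= x -> 0 <= (x %/ N)%Z.
Proof. by have := floor_bounds x; nia. Qed.

Lemma floor_opp x y : ~~ congr_mod x y ->
  ((x - y) %/ N)%Z + ((y - x) %/ N)%Z = -1.
Proof.
move=> /negP nxy; suff -> : ((y - x) %/ N)%Z = -1 - ((x - y) %/ N)%Z by lia.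
apply: floor_unique; have := floor_bounds (x - y).
suff : x - y <> ((x - y) %/ N)%Z * N by lia.
by move=> E; apply: nxy; apply/congr_modP; exists ((x - y) %/ N)%Z; lia.
Qed.

Lemma floor_succ x y : ~~ congr_mod (x + 1) y ->
  ((x + 1 - y) %/ N)%Z = ((x - y) %/ N)%Z.
Proof.
move=> /negP nxy; apply: floor_unique; have := floor_bounds (x - y).
suff : x + 1 - y <> ((x - y) %/ N)%Z * N + N by lia.
by move=> E; apply: nxy; apply/congr_modP; exists (((x - y) %/ N)%Z + 1); lia.
Qed.

(** The integers 1, ..., n, as a window of representatives modulo n. *)
Definition letter a : int := a.+1%:Z.

Lemma letter_exists x : exists a, congr_mod x (letter a).
Proof.
have r_lt : (`|((x - 1) %% N)%Z| < n)%N.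
  by have := @modz_ge0 (x - 1) N; have := ltz_pmod (x - 1) (n_gt0 : 0 < N); lia.
exists (Ordinal r_lt); apply/congr_modP; exists ((x - 1) %/ N)%Z.
have := divz_eq (x - 1) N; have := @modz_ge0 (x - 1) N.
by rewrite /letter /=; lia.
Qed.

Lemma letter_inj a b : congr_mod (letter a) (letter b) = (a == b).
Proof.
apply/idP/eqP => [ab|->]; last exact: congr_refl.
apply/val_inj/eqP; have := congr_close ab; rewrite /letter /=.
by have := ltn_ord a; have := ltn_ord b; lia.
Qed.

Definition periodic_fun h := forall x, h (x + N) = h x.

Lemma periodic_fun_shift h x m : periodic_fun h -> h (x + m * N) = h x.
Proof.
move=> hN; have nat_shift y (d : nat) : h (y + d%:Z * N) = h y.
  elim: d => [|d IHd]; first by rewrite mul0r addr0.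
  by rewrite -IHd -(hN (y + d%:Z * N)); congr h; lia.
case: m => d; first exact: nat_shift.
by rewrite -(nat_shift (x + Negz d * N) d.+1); congr h; lia.
Qed.

Lemma periodic_fun_congr h x y : periodic_fun h -> congr_mod x y -> h x = h y.
Proof. by move=> hN /congr_modP[m ->]; exact: periodic_fun_shift. Qed.

(** Both windows meet every residue class modulo n exactly once. *)
Lemma sum_window h (r : 'I_n -> int) : periodic_fun h ->
    (forall a b, congr_mod (r a) (r b) -> a = b) ->
  \sum_a h (r a) = \sum_a h (letter a).
Proof.
move=> hN r_inj; have [s rs] := choice (fun a => letter_exists (r a)).
rewrite [RHS](reindex_inj (h := s)) /=.
  by apply: eq_bigr => a _; exact: periodic_fun_congr.
move=> a b E; apply: r_inj; rewrite (congr_transl _ (rs a)) congr_sym.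
by rewrite (congr_transl _ (rs b)) E congr_refl.
Qed.

Lemma affine_shift f x m : is_affine n f -> f (x + m * N) = f x + m * N.
Proof.
case=> _ fN; have hN : periodic_fun (fun y => f y - y).
  by move=> y /=; rewrite fN; lia.
by have /= := @periodic_fun_shift _ x m hN; lia.
Qed.

Lemma affine_congr f x y : is_affine n f ->
  congr_mod (f x) (f y) = congr_mod x y.
Proof.
move=> aff; apply/congr_modP/congr_modP => -[m].
  by rewrite -affine_shift // => /(bij_inj aff.1) ->; exists m.
by move=> ->; exists m; rewrite affine_shift.
Qed.

Lemma affine_id : is_affine n id.
Proof. by split=> //; exists id. Qed.

Lemma affine_comp f g : is_affine n f -> is_affine n g -> is_affine n (f \o g).
Proof.
move=> [bf fN] [bg gN]; split; first exact: bij_comp.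
by move=> x /=; rewrite gN fN.
Qed.

Definition adeg f : int := \sum_a (f (letter a) - letter a).

Lemma affine_degP d f :
  is_affine_deg n d f <-> is_affine n f /\ adeg f = (n * d)%:Z.
Proof. by rewrite /is_affine_deg big_add1 big_mkord. Qed.

Lemma adeg_window f (r : 'I_n -> int) : is_affine n f ->
    (forall a b, congr_mod (r a) (r b) -> a = b) ->
  \sum_a (f (r a) - r a) = adeg f.
Proof.
move=> [_ fN]; apply: (sum_window (h := fun x => f x - x)) => x.
by rewrite fN; lia.
Qed.

(** Write f(g(x)) - x as (f(g(x)) - g(x)) + (g(x) - x) and sum the first part over
    the window moved by g. *)
Lemma adeg_comp f g : is_affine n f -> is_affine n g ->
  adeg (f \o g) = adeg f + adeg g.
Proof.
move=> af ag; rewrite -(@adeg_window f (g \o letter)) //.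
  by rewrite /adeg -big_split; apply: eq_bigr => a _ /=; rewrite addrA subrK.
by move=> a b; rewrite /= affine_congr // letter_inj => /eqP.
Qed.

Lemma adeg_id : adeg id = 0.
Proof. by rewrite /adeg big1 // => a _; rewrite subrr. Qed.

Lemma adeg_translation m : adeg (fun x => x + m) = N * m.
Proof.
rewrite /adeg (eq_bigr (fun=> m)); last by move=> a _; rewrite addrC addKr.
by rewrite sumr_const card_ord -mulr_natl natz.
Qed.

Lemma affine_translation m : is_affine n (fun x => x + m).
Proof.
split; last by move=> x; lia.
by exists (fun x => x - m) => x; lia.
Qed.

(** The affine reflection exchanging p + r n and q + r n for all r, when p and q
    are incongruent. *)
Definition aswap p q x : int :=
  if congr_mod x p then x + (q - p) else
  if congr_mod x q then x + (p - q) else x.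

Lemma aswapL p q : aswap p q p = q.
Proof. by rewrite /aswap congr_refl; lia. Qed.

Lemma aswapR p q : ~~ congr_mod p q -> aswap p q q = p.
Proof. by rewrite /aswap congr_sym => /negbTE->; rewrite congr_refl; lia. Qed.

Lemma aswapD p q x : ~~ congr_mod x p -> ~~ congr_mod x q -> aswap p q x = x.
Proof. by rewrite /aswap => /negbTE-> /negbTE->. Qed.

Lemma aswap_shift p q x m : aswap p q (x + m * N) = aswap p q x + m * N.
Proof. by rewrite /aswap !congr_shift; do 2?case: ifP => _; lia. Qed.

Lemma aswapC p q : ~~ congr_mod p q -> aswap p q = aswap q p.
Proof.
move=> npq; apply/funext=> x; rewrite /aswap.
case: ifP => // xp; case: ifP => // xq; case/negP: npq.
by rewrite -(congr_transl _ xp).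
Qed.

Lemma aswap_translate p q m : aswap (p + m * N) (q + m * N) = aswap p q.
Proof.
apply/funext=> x; rewrite /aswap -!(congr_sym (_ + _)) !congr_shift.
by rewrite !(congr_sym _ x); do 2?case: ifP => _; lia.
Qed.

Lemma aswapK p q : ~~ congr_mod p q -> involutive (aswap p q).
Proof.
move=> npq x; have [/congr_modP[m ->]|nxp] := boolP (congr_mod x p).
  by rewrite !(aswap_shift, aswapL) aswapR.
have [/congr_modP[m ->]|nxq] := boolP (congr_mod x q).
  by rewrite aswap_shift aswapR // aswap_shift aswapL.
by rewrite !(aswapD nxp nxq).
Qed.

Lemma affine_aswap p q : ~~ congr_mod p q -> is_affine n (aswap p q).
Proof.
move=> npq; split; first by exists (aswap p q); exact: aswapK.
by move=> x; have := aswap_shift p q x 1; rewrite mul1r.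
Qed.

Lemma adeg_aswap p q : ~~ congr_mod p q -> adeg (aswap p q) = 0.
Proof.
move=> npq; have aff := affine_aswap npq.
have := adeg_comp aff aff.
have -> : aswap p q \o aswap p q = id by apply/funext=> x /=; exact: aswapK.
by rewrite adeg_id; lia.
Qed.

Lemma aswap_comp f p q : is_affine n f -> ~~ congr_mod p q ->
  f \o aswap p q = aswap (f p) (f q) \o f.
Proof.
move=> aff npq; apply/funext=> x /=.
have [/congr_modP[m ->]|nxp] := boolP (congr_mod x p).
  by rewrite aswap_shift aswapL !(affine_shift _ _ aff) aswap_shift aswapL.
have [/congr_modP[m ->]|nxq] := boolP (congr_mod x q).
  rewrite aswap_shift aswapR // !(affine_shift _ _ aff) aswap_shift aswapR //.
  by rewrite affine_congr.
by rewrite !aswapD // affine_congr.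
Qed.

Lemma affine_deg_aswap d f p q : is_affine_deg n d f -> ~~ congr_mod p q ->
  is_affine_deg n d (f \o aswap p q).
Proof.
move=> /affine_degP[aff deg] npq; apply/affine_degP.
split; first exact/affine_comp/affine_aswap.
by rewrite adeg_comp ?adeg_aswap ?addr0 //; exact: affine_aswap.
Qed.

Definition window_floor (r : 'I_n -> int) a b : int := ((r a - r b) %/ N)%Z.

(** Twice the Coxeter length: the term at (a, b) counts the inversions between
    the residue classes of a and b. *)
Definition affine_disc f : nat :=
  disc (window_floor letter) (window_floor (f \o letter)).

(** Moving a representative by a multiple of n shifts both floors by the same
    integer. *)
Lemma affine_disc_window f (r : 'I_n -> int) : is_affine n f ->
    (forall a, congr_mod (r a) (letter a)) ->
  disc (window_floor r) (window_floor (f \o r)) = affine_disc f.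
Proof.
move=> aff r_letter; apply: eq_bigr => -[a b] _; rewrite /window_floor /=.
have /congr_modP[m ->] := r_letter a; have /congr_modP[l ->] := r_letter b.
rewrite !(affine_shift _ _ aff).
have shift x y : ((x + m * N - (y + l * N)) %/ N)%Z = ((x - y) %/ N)%Z + (m - l).
  by rewrite -floor_shift //; congr (_ %/ _)%Z; lia.
by rewrite !shift; congr absz; lia.
Qed.

Lemma window_floor_like (r : 'I_n -> int) :
  (forall a b, congr_mod (r a) (r b) -> a = b) -> floor_like (window_floor r).
Proof.
move=> r_inj; split=> [a|a b nab]; first by rewrite /window_floor subrr div0z.
by apply: floor_opp => //; apply: contra nab => /r_inj->.
Qed.

(** With p and q among the representatives, the reflection becomes a
    transposition of indices. *)
Lemma swap_window p q : ~~ congr_mod p q ->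
  exists (a b : 'I_n) (r : 'I_n -> int),
    [/\ a != b, r a = p, r b = q, forall c, congr_mod (r c) (letter c) &
        forall f, is_affine n f ->
          f \o aswap p q \o r = (f \o r) \o tperm a b].
Proof.
move=> npq; have [a pa] := letter_exists p.
have [b qb] := letter_exists q.
have nab : a != b.
  apply: contra npq => /eqP ab; rewrite (congr_transl _ pa) ab congr_sym.
  by rewrite (congr_transl _ qb) congr_refl.
pose r c := if c == a then p else if c == b then q else letter c.
have ra : r a = p by rewrite /r eqxx.
have rb : r b = q by rewrite /r eq_sym (negbTE nab) eqxx.
have rc c : congr_mod (r c) (letter c).
  rewrite /r; case: eqP => [->//|_]; case: eqP => [->//|_].
  exact: congr_refl.
exists a, b, r; split=> // f aff; apply/funext=> c /=; congr f.
case: tpermP => [->|->|/eqP ca /eqP cb]; rewrite ?ra ?rb.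
- exact: aswapL.
- exact: aswapR.
by rewrite aswapD //; rewrite (congr_transl _ (rc c)) congr_sym;
  [rewrite (congr_transl _ pa) | rewrite (congr_transl _ qb)];
  rewrite letter_inj eq_sym.
Qed.

Lemma affine_disc_swap_lt f p q : is_affine n f -> p < q -> ~~ congr_mod p q ->
  f p < f q -> (affine_disc f < affine_disc (f \o aswap p q))%N.
Proof.
move=> aff pq npq fpq; have [a [b [r [nab ra rb rc comp]]]] := swap_window npq.
have r_inj c d : congr_mod (r c) (r d) -> c = d.
  rewrite (congr_transl _ (rc c)) congr_sym (congr_transl _ (rc d)) congr_sym.
  by rewrite letter_inj // => /eqP.
rewrite -!(affine_disc_window (r := r)) //; last exact/affine_comp/affine_aswap.
rewrite comp //.
apply: (@disc_swap_lt _ (window_floor r) (window_floor (f \o r)) a b) => //.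
- exact: window_floor_like.
- by apply: window_floor_like => c d /=; rewrite affine_congr //; apply: r_inj.
- by apply: floor_ge0 => //; rewrite ra rb; lia.
- by apply: floor_ge0 => //; rewrite /= ra rb; lia.
by move=> c _ _; rewrite /window_floor /= ra rb; split; apply: floor_mono => //; lia.
Qed.

Lemma affine_disc_swap_add2 f p : is_affine n f -> (1 < n)%N ->
  f p < f (p + 1) -> affine_disc (f \o aswap p (p + 1)) = (affine_disc f).+2.
Proof.
move=> aff n_gt1 fpq; set q := p + 1.
have npq : ~~ congr_mod p q.
  by apply/negP => /(congr_close); rewrite /q; lia.
have [a [b [r [nab ra rb rc comp]]]] := swap_window npq.
have r_inj c d : congr_mod (r c) (r d) -> c = d.
  rewrite (congr_transl _ (rc c)) congr_sym (congr_transl _ (rc d)) congr_sym.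
  by rewrite letter_inj // => /eqP.
rewrite -!(affine_disc_window (r := r)) //; last exact/affine_comp/affine_aswap.
rewrite comp //.
apply: (@disc_swap_add2 _ (window_floor r) (window_floor (f \o r)) a b) => //.
- exact: window_floor_like.
- by apply: window_floor_like => c d /=; rewrite affine_congr //; apply: r_inj.
- by apply: floor_unique => //; rewrite ra rb /q; lia.
- by apply: floor_ge0 => //; rewrite /= ra rb /q; lia.
move=> c ca cb; left; rewrite /window_floor ra rb /q floor_succ // -/q -rb.
by apply: contra cb => /r_inj->.
Qed.

Lemma is_simpleP s :
  is_simple n s <-> (1 < n)%N /\ exists p, s = aswap p (p + 1).
Proof.
split=> [[i [onS off]]|[n_gt1 [p ->]]].
  have n_gt1 : (1 < n)%N.
    have [//|n_le1] := ltnP 1 n; have n1 : n = 1%N by lia.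
    have := (onS 1).1; have := (onS 0).2.
    have -> : i%:Z + 1 + 0 * N = i%:Z + 1 * N by lia.
    by move=> ->; lia.
  split=> //; exists i%:Z; apply/funext=> x.
  have npq : ~~ congr_mod i%:Z (i%:Z + 1).
    by apply/negP => /(congr_close); lia.
  have [/congr_modP[m ->]|nxp] := boolP (congr_mod x i%:Z).
    by rewrite aswap_shift aswapL (onS m).1.
  have [/congr_modP[m ->]|nxq] := boolP (congr_mod x (i%:Z + 1)).
    by rewrite aswap_shift aswapR // (onS m).2.
  rewrite aswapD // off // => m; split=> E.
    by case/negP: nxp; apply/congr_modP; exists m.
  by case/negP: nxq; apply/congr_modP; exists m.
have [a pa] := letter_exists (p + 1).
have /congr_modP[m def_p] : congr_mod p a%:Z.
  case/congr_modP: pa => m E; apply/congr_modP; exists m.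
  by move: E; rewrite /letter; lia.
have -> : p + 1 = a%:Z + 1 + m * N by rewrite def_p; lia.
rewrite def_p aswap_translate.
have npq : ~~ congr_mod a%:Z (a%:Z + 1).
  by apply/negP => /(congr_close); lia.
exists a; split=> [r|x off].
  by rewrite !aswap_shift aswapL aswapR.
apply: aswapD; apply/negP => /congr_modP[r E]; have [] := off r; rewrite E.
  by [].
by move=> _.
Qed.

Lemma simple_not_congr p : (1 < n)%N -> ~~ congr_mod p (p + 1).
Proof. by move=> n_gt1; apply/negP => /(congr_close); lia. Qed.

(** Words are built on the left; multiplying by a swap of adjacent positions,
    which the length formula controls, happens on the right. *)
Lemma simple_product_rcons (m : nat) f : is_simple_product n m.+1 f <->
  exists g s, [/\ is_simple_product n m g, is_simple n s & f = g \o s].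
Proof.
elim: m f => [|m IHm] f.
  split=> [[s [g [ss -> ->]]]|[g [s [-> ss ->]]]]; first by exists id, s.
  by exists s, id.
split=> [[s [g [ss /IHm[h [s' [gh ss' ->]]] ->]]]
        |[g [s [[s' [h [ss' hm ->]]] ss ->]]]].
  by exists (s \o h), s'; split=> //; exists s, h.
by exists s', (h \o s); split=> //; apply/IHm; exists h, s.
Qed.

Lemma simple_product_deg (m : nat) f :
  is_simple_product n m f -> is_affine_deg n 0 f.
Proof.
elim: m f => [|m IHm] f.
  move=> /= ->; apply/affine_degP; rewrite adeg_id muln0.
  by split=> //; exact: affine_id.
case/simple_product_rcons => g [s [/IHm deg_g /is_simpleP[n_gt1 [p ->]] ->]].
by apply: affine_deg_aswap => //; exact: simple_not_congr.
Qed.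

Lemma affine_disc_id : affine_disc id = 0%N.
Proof. by apply: big1 => x _ /=; rewrite subrr. Qed.

Lemma simple_product_disc (m : nat) f :
  is_simple_product n m f -> (affine_disc f <= m.*2)%N.
Proof.
elim: m f => [|m IHm] f; first by move=> /= ->; rewrite affine_disc_id.
case/simple_product_rcons => g [s [gm /is_simpleP[n_gt1 [p ->]] ->]].
have [aff _] := simple_product_deg gm; have len := IHm _ gm.
have npq := simple_not_congr p n_gt1.
have [up|down] : g p < g (p + 1) \/ g (p + 1) < g p.
  have : g p <> g (p + 1).
    by move/(bij_inj aff.1) => E; move: npq; rewrite -E congr_refl.
  by lia.
  by rewrite affine_disc_swap_add2 //; lia.
have aff' : is_affine n (g \o aswap p (p + 1)) by exact/affine_comp/affine_aswap.
have := affine_disc_swap_add2 (p := p) aff' n_gt1.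
rewrite /= aswapL aswapR // => /(_ down).
have -> : (g \o aswap p (p + 1)) \o aswap p (p + 1) = g.
  by apply/funext=> x /=; rewrite aswapK.
by lia.
Qed.

(** Since f(p + n) = f(p) + n, n positive increments add up to n, so each of them
    is 1 and f is a translation; degree 0 makes it the identity. *)
Lemma affine_increasing_id f : is_affine_deg n 0 f ->
  (forall p, f p < f (p + 1)) -> f = id.
Proof.
move=> /affine_degP[[bf fN] deg] incr.
have grow p (d : nat) : f p + d%:Z <= f (p + d%:Z).
  elim: d => [|d IHd]; first by rewrite !addr0.
  by have := incr (p + d%:Z); have -> : p + d%:Z + 1 = p + d.+1%:Z; lia.
have succ p : f (p + 1) = f p + 1.
  have := incr p; have := grow (p + 1) n.-1.
  by have -> : p + 1 + n.-1%:Z = p + N; rewrite ?fN; lia.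
have natE (d : nat) p : f (p + d%:Z) = f p + d%:Z.
  elim: d => [|d IHd]; first by rewrite !addr0.
  by have -> : p + d.+1%:Z = p + d%:Z + 1; rewrite ?succ ?IHd; lia.
have shift x : f x = f 0 + x.
  case: x => d; first by have := natE d 0; rewrite add0r.
  have := natE d.+1 (Negz d); have -> : Negz d + d.+1%:Z = 0 by lia.
  by lia.
have f0 : f 0 = 0.
  move: deg; rewrite /adeg (eq_bigr (fun=> f 0)); last first.
    by move=> a _; rewrite shift addrK.
  by rewrite sumr_const card_ord -mulr_natl natz muln0; nia.
by apply/funext=> x; rewrite shift f0 add0r.
Qed.

(** Undoing a descent lowers the sum by two, and without descents f is the
    identity. *)
Lemma simple_product_exists f : is_affine_deg n 0 f ->
  exists2 m, is_simple_product n m f & affine_disc f = m.*2.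
Proof.
have [l] := ubnP (affine_disc f); elim: l f => // l IHl f; rewrite ltnS => fl deg.
have [incr|] := pselect (forall p, f p < f (p + 1)).
  by exists 0%N; rewrite ?(affine_increasing_id deg incr) ?affine_disc_id.
move=> /existsNP[p] np; have [aff _] := deg.
have n_gt1 : (1 < n)%N.
  have [//|n_le1] := ltnP 1 n; have n1 : n = 1%N by lia.
  by have := aff.2 p; have -> : N = 1 by [rewrite n1]; lia.
have npq := simple_not_congr p n_gt1.
have down : f (p + 1) < f p.
  have : f p <> f (p + 1).
    by move/(bij_inj aff.1) => E; move: npq; rewrite -E congr_refl.
  by lia.
have deg' : is_affine_deg n 0 (f \o aswap p (p + 1)) by exact: affine_deg_aswap.
have invol : (f \o aswap p (p + 1)) \o aswap p (p + 1) = f.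
  by apply/funext=> x /=; rewrite aswapK.
have := affine_disc_swap_add2 (p := p) deg'.1 n_gt1.
rewrite invol /= aswapL aswapR // => /(_ down) add2.
have [|m prod_m len_m] := IHl _ _ deg'; first by lia.
exists m.+1; last by rewrite add2 len_m.
apply/simple_product_rcons; exists (f \o aswap p (p + 1)), (aswap p (p + 1)).
by split=> //; apply/is_simpleP; split=> //; exists p.
Qed.

Lemma coxeter_lengthP f (m : nat) :
  coxeter_length n f m <-> is_affine_deg n 0 f /\ affine_disc f = m.*2.
Proof.
split=> [[prod_m min_m]|[deg len]].
  have deg := simple_product_deg prod_m; split=> //.
  have [l prod_l len_l] := simple_product_exists deg.
  by have := min_m _ prod_l; have := simple_product_disc prod_m; lia.
have [l prod_l len_l] := simple_product_exists deg.
have -> : m = l by lia.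
by split=> // l' /simple_product_disc; lia.
Qed.

Lemma is_reflection_conj s t : is_simple n s -> is_reflection n t ->
  is_reflection n (s \o t \o s).
Proof.
move=> /is_simpleP[n_gt1 [p ->]] [s' [g [h [ss' deg gK hK ->]]]].
have npq := simple_not_congr p n_gt1.
exists s', (aswap p (p + 1) \o g), (h \o aswap p (p + 1)); split=> //.
- case/affine_degP: deg => aff deg; apply/affine_degP.
  split; first exact/affine_comp/aff/affine_aswap.
  by rewrite adeg_comp // ?adeg_aswap // ?deg ?add0r //; exact: affine_aswap.
- by move=> x /=; rewrite aswapK // gK.
- by move=> x /=; rewrite hK aswapK.
Qed.

(** Conjugating by the simple reflection at p brings q closer to p, and two
    adjacent positions are swapped by a simple reflection. *)
Lemma reflection_aswap p q : p < q -> ~~ congr_mod p q ->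
  is_reflection n (aswap p q).
Proof.
move=> pq npq; have n_gt1 : (1 < n)%N.
  have [//|n_le1] := ltnP 1 n; have n1 : n = 1%N by lia.
  by case/negP: npq; apply/congr_modP; exists (p - q); rewrite n1; lia.
have [d] := ubnP `|q - p|%N; elim: d p q pq npq => // d IHd p q pq npq.
rewrite ltnS => qpd.
have [->|q_neq] := eqVneq q (p + 1).
  exists (aswap p (p + 1)), id, id; split=> //.
    by apply/is_simpleP; split=> //; exists p.
  by apply/affine_degP; rewrite adeg_id muln0; split=> //; exact: affine_id.
have npp := simple_not_congr p n_gt1.
have aff := affine_aswap npp.
pose q' := aswap p (p + 1) q.
have q'E : q' = q \/ q' = q - 1 /\ congr_mod q (p + 1).
  rewrite /q' /aswap congr_sym (negbTE npq); case: ifP => qp1; last by left.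
  by right; split=> //; lia.
have pq' : p + 1 < q'.
  case: q'E => [->|[-> /congr_modP[m E]]]; first by lia.
  have [m_le0|m_gt0] : m <= 0 \/ 1 <= m by lia.
    (* Here q is p + 1 + m n with p < q and q <> p + 1, so m >= 1, and n >= 2. *)
    have : m * N <= 0 by apply: mulr_le0_ge0.
    by lia.
  have : N <= m * N by rewrite ler_peMl.
  by lia.
have npq' : ~~ congr_mod (p + 1) q'.
  by rewrite -{1}(aswapL p (p + 1)) affine_congr.
have -> : aswap p q =
    aswap p (p + 1) \o aswap (p + 1) q' \o aswap p (p + 1).
  have := aswap_comp aff npq; rewrite aswapL -/q' => E.
  rewrite -compA -/(_ \o _); apply/funext=> x /=.
  have /= <- := congr1 (@^~ x) E.
  by rewrite aswapK.
apply: is_reflection_conj; first by apply/is_simpleP; split=> //; exists p.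
by apply: IHd => //; case: q'E => [|[]] *; lia.
Qed.

Lemma reflectionP t : is_reflection n t <->
  exists p q, [/\ p < q, ~~ congr_mod p q & t = aswap p q].
Proof.
split=> [[s [g [h [/is_simpleP[n_gt1 [p ->]] [aff _] gK hK ->]]]]|]; last first.
  by case=> p [q [pq npq ->]]; exact: reflection_aswap.
have npq := simple_not_congr p n_gt1.
have -> : g \o aswap p (p + 1) \o h = aswap (g p) (g (p + 1)).
  by rewrite aswap_comp //; apply/funext=> x /=; rewrite hK.
have ngpq : ~~ congr_mod (g p) (g (p + 1)) by rewrite affine_congr.
have [lt|lt] : g p < g (p + 1) \/ g (p + 1) < g p.
  have : g p <> g (p + 1) by move=> E; move: ngpq; rewrite E congr_refl.
  by lia.
  by exists (g p), (g (p + 1)).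
by exists (g (p + 1)), (g p); rewrite aswapC // congr_sym.
Qed.

(** A step of Bruhat order on the component of degree d, freed from Coxeter
    length. *)
Definition affine_up (d : nat) f g := is_affine_deg n d f /\
  exists p q, [/\ p < q, ~~ congr_mod p q, f p < f q & g = f \o aswap p q].

Lemma coxeter_stepP f g : coxeter_step n f g <-> affine_up 0 f g.
Proof.
split=> [[t [a [b [/reflectionP[p [q [pq npq ->]]] -> ]]]]|].
  move=> /coxeter_lengthP[deg len_a] /coxeter_lengthP[deg' len_b] ab.
  split=> //; exists p, q; split=> //.
  have [//|fqp] := ltP (f p) (f q); have [aff _] := deg.
  have lt : f q < f p.
    have : f p <> f q by move/(bij_inj aff.1); lia.
    by lia.
  have := affine_disc_swap_lt (p := p) (q := q) deg'.1 pq npq.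
  rewrite /= aswapL aswapR // => /(_ lt).
  have -> : (f \o aswap p q) \o aswap p q = f.
    by apply/funext=> x /=; rewrite aswapK.
  by lia.
case=> deg [p [q [pq npq fpq ->]]]; have deg' := affine_deg_aswap deg npq.
have [a prod_a len_a] := simple_product_exists deg.
have [b prod_b len_b] := simple_product_exists deg'.
exists (aswap p q), a, b; split=> //.
- exact: reflection_aswap.
- exact/coxeter_lengthP.
- exact/coxeter_lengthP.
by have := affine_disc_swap_lt deg.1 pq npq fpq; lia.
Qed.

(** The transport between the components only renames positions. *)
Lemma affine_up_shift d f g :
  affine_up 0 (fun i => f (i - d%:Z)) (fun i => g (i - d%:Z)) <-> affine_up d f g.
Proof.
have affE : is_affine_deg n 0 (fun i => f (i - d%:Z)) <-> is_affine_deg n d f.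
  have comp h : (fun i => h (i - d%:Z)) = h \o (fun x => x + - d%:Z) by [].
  split=> /affine_degP[aff deg]; apply/affine_degP.
    have def_f : f = (fun i => f (i - d%:Z)) \o (fun x => x + d%:Z).
      by apply/funext=> x /=; rewrite addrK.
    rewrite def_f adeg_comp //; last exact: affine_translation.
    rewrite deg adeg_translation // muln0 add0r PoszM.
    by split=> //; apply: affine_comp => //; exact: affine_translation.
  rewrite comp adeg_comp //; last exact: affine_translation.
  rewrite deg adeg_translation //; split; last by lia.
  by apply: affine_comp => //; exact: affine_translation.
have swapE p q : aswap p q \o (fun i => i - d%:Z) =
    (fun i => i - d%:Z) \o aswap (p + d%:Z) (q + d%:Z).
  apply/funext=> x /=; rewrite /aswap /congr_mod.
  have shift y : x - d%:Z - y = x - (y + d%:Z) by lia.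
  by rewrite !shift; do 2?case: ifP => _; lia.
split=> -[/affE deg [p [q [pq npq fpq E]]]]; split=> //.
  exists (p - d%:Z), (q - d%:Z); split=> //; first by lia.
    move: npq; rewrite /congr_mod.
    by have -> : p - d%:Z - (q - d%:Z) = p - q by lia.
  apply/funext=> x; have /= := congr1 (@^~ (x + d%:Z)) E; rewrite addrK => ->.
  have /= := congr1 (@^~ (x + d%:Z)) (swapE (p - d%:Z) (q - d%:Z)).
  by rewrite addrK !subrK => ->.
exists (p + d%:Z), (q + d%:Z); split; rewrite ?addrK //; first by lia.
  move: npq; rewrite /congr_mod.
  by have -> : p + d%:Z - (q + d%:Z) = p - q by lia.
by rewrite E; apply/funext=> x /=; have /= := congr1 (@^~ x) (swapE p q) => ->.
Qed.

Lemma affine_bruhatP d f g :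
  affine_bruhat_le n d f g <->
  Relation_Operators.clos_refl_trans _ (affine_up d) f g.
Proof.
split=> [le_fg|].
  have H F G : Relation_Operators.clos_refl_trans _ (coxeter_step n) F G ->
    Relation_Operators.clos_refl_trans _ (affine_up d)
      (fun x => F (x + d%:Z)) (fun x => G (x + d%:Z)).
    elim=> [{}F {}G /coxeter_stepP step|{}F|F1 F2 F3 _ IH1 _ IH2].
    - apply: Relation_Operators.rt_step; apply/affine_up_shift.
      under eq_fun do rewrite subrK.
      by under [X in affine_up _ _ X]eq_fun do rewrite subrK.
    - exact: Relation_Operators.rt_refl.
    - exact: Relation_Operators.rt_trans IH1 IH2.
  have := H _ _ le_fg.
  under eq_fun do rewrite addrK.
  by under [X in Relation_Operators.clos_refl_trans _ _ _ X]eq_fun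
    do rewrite addrK.
elim=> [F G step|F|F1 F2 F3 _ IH1 _ IH2].
- by apply: Relation_Operators.rt_step; apply/coxeter_stepP/affine_up_shift.
- exact: Relation_Operators.rt_refl.
- exact: Relation_Operators.rt_trans IH1 IH2.
Qed.

Lemma affine_up_disc d f g : affine_up d f g ->
  is_affine_deg n d g /\ (affine_disc f < affine_disc g)%N.
Proof.
case=> deg [p [q [pq npq fpq ->]]]; split; first exact: affine_deg_aswap.
exact: affine_disc_swap_lt deg.1 _ _ _.
Qed.

Lemma affine_bruhat_disc d f g : affine_bruhat_le n d f g ->
  (affine_disc f <= affine_disc g)%N /\ (affine_disc f = affine_disc g -> f = g).
Proof.
move/affine_bruhatP; elim=> [{}f {}g /affine_up_disc[_]|//|f1 f2 f3 _ IH1 _ IH2].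
  by lia.
case: IH1 IH2 => le1 eq1 [le2 eq2]; split=> [|E]; first by lia.
by apply: (etrans (eq1 _) (eq2 _)); move: le1 le2 E; clear; lia.
Qed.

Lemma affine_bruhat_order d (A : set (int -> int)) :
  partial_order_on A (affine_bruhat_le n d).
Proof.
split=> [f _|f g _ _ fg gf|f g h _ _ _].
- exact: Relation_Operators.rt_refl.
- have [le1 eq1] := affine_bruhat_disc fg.
  have [le2 _] := affine_bruhat_disc gf.
  by apply: eq1; lia.
exact: Relation_Operators.rt_trans.
Qed.

End Affine.

(** * From pairs of permutations to bounded affine permutations *)

Section BoundedAffine.
Local Open Scope ring_scope.
Variables n k : nat.
Hypotheses (n_gt0 : (0 < n)%N) (le_kn : (k <= n)%N).
Implicit Types (f g h : int -> int) (p q m : int) (a b c i j : 'I_n)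
  (u v w x y z : 'S_n).

Local Notation N := (n%:Z).

Lemma letter_bounds a : 1 <= letter a <= N.
Proof. by rewrite /letter; have := ltn_ord a; lia. Qed.

Lemma letter_lt a b : (letter a < letter b) = (a < b)%N.
Proof. by rewrite /letter; lia. Qed.

Lemma int_letter p : exists a m, p = letter a + m * N.
Proof.
by have [a /congr_modP[m ->]] := letter_exists n_gt0 p; exists a, m.
Qed.

Lemma letter_shift_inj a b m m' :
  letter a + m * N = letter b + m' * N -> a = b /\ m = m'.
Proof.
move=> E; have ab : a = b.
  apply/eqP; rewrite -(letter_inj n_gt0); apply/congr_modP; exists (m' - m).
  by rewrite mulrBl; lia.
split=> //; move: E; rewrite ab => /addrI/mulIf; apply; lia.
Qed.

Lemma letter_divmod a m : ((letter a + m * N - 1) %/ N)%Z = m /\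
  ((letter a + m * N - 1) %% N)%Z = a%:Z.
Proof.
have quo : ((letter a + m * N - 1) %/ N)%Z = m.
  by apply: floor_unique => //; rewrite /letter; have := ltn_ord a; lia.
split=> //; have := divz_eq (letter a + m * N - 1) N; rewrite quo /letter.
by lia.
Qed.

Lemma periodicE u a m : periodic u (letter a + m * N) = letter (u a) + m * N.
Proof.
have [quo rem] := letter_divmod a m.
rewrite /periodic quo rem /=; case: insubP => [b _ /= /val_inj->//|].
by rewrite ltn_ord.
Qed.

Lemma t_omegaE a m :
  t_omega n k (letter a + m * N) = letter a + (m + (a < k)%N%:Z) * N.
Proof.
have [quo rem] := letter_divmod a m.
rewrite /t_omega rem ltz_nat; case: ltnP => _ /=; last by rewrite addr0.
by rewrite mulrDl mul1r addrA.
Qed.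

Lemma f_uwE u w a m : f_uw k u w (letter (w a) + m * N) =
  letter (u a) + (m + (a < k)%N%:Z) * N.
Proof. by rewrite /f_uw /= periodicE permK t_omegaE periodicE. Qed.

Lemma f_uwE0 u w a : f_uw k u w (letter (w a)) =
  letter (u a) + (a < k)%N%:Z * N.
Proof. by have := f_uwE u w a 0; rewrite mul0r addr0 add0r. Qed.

Lemma periodic_affine u : is_affine n (periodic u).
Proof.
split.
  exists (periodic (u^-1)%g) => p; have [a [m ->]] := int_letter p.
    by rewrite !periodicE permK.
  by rewrite !periodicE permKV.
move=> p; have [a [m ->]] := int_letter p.
have -> : letter a + m * N + N = letter a + (m + 1) * N by lia.
by rewrite !periodicE; lia.
Qed.

Lemma t_omega_affine : is_affine n (t_omega n k).
Proof.
split.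
  pose g p : int := if ((p - 1) %% N)%Z < k%:Z then p - N else p.
  have gE a m : g (letter a + m * N) = letter a + (m - (a < k)%N%:Z) * N.
    have [quo rem] := letter_divmod a m.
    rewrite /g rem ltz_nat; case: ltnP => _ /=; last by rewrite subr0.
    by rewrite mulrBl mul1r addrA.
  exists g => p; have [a [m ->]] := int_letter p; rewrite ?(t_omegaE, gE).
    by rewrite addrK.
  by rewrite subrK.
move=> p; have [a [m ->]] := int_letter p.
have -> : letter a + m * N + N = letter a + (m + 1) * N by lia.
by rewrite !t_omegaE; lia.
Qed.

Lemma adeg_periodic u : adeg n (periodic u) = 0.
Proof.
rewrite /adeg sumrB (eq_bigr (fun a => letter (u a))).
  rewrite -(reindex_inj (h := u) (P := xpredT) (F := @letter n)) ?subrr //.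
  exact: perm_inj.
by move=> a _; have := periodicE u a 0; rewrite !mul0r !addr0.
Qed.

Lemma card_ord_lt : #|[pred a : 'I_n | (a < k)%N]| = k.
Proof.
rewrite -sum1_card -(big_ord_widen _ (fun=> 1%N) le_kn).
by rewrite sum1_card card_ord.
Qed.

Lemma adeg_t_omega : adeg n (t_omega n k) = N * k%:Z.
Proof.
rewrite /adeg (eq_bigr (fun a : 'I_n => if (a < k)%N then N else 0)).
  by rewrite -big_mkcond /= sumr_const card_ord_lt -mulr_natr natz.
move=> a _; have := t_omegaE a 0; rewrite mul0r addr0 => ->.
by case: (a < k)%N; lia.
Qed.

Lemma f_uw_affine u w : is_affine n (f_uw k u w).
Proof.
by do 2?apply: affine_comp; first apply: periodic_affine;
  do 1?exact: t_omega_affine; exact: periodic_affine.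
Qed.

Lemma f_uw_deg u w : is_affine_deg n k (f_uw k u w).
Proof.
have ap := periodic_affine; have at_ := t_omega_affine.
apply/affine_degP; split; first exact: f_uw_affine.
rewrite /f_uw adeg_comp // ?adeg_comp // ?adeg_periodic ?adeg_t_omega.
  by lia.
exact: affine_comp.
Qed.

(** An affine permutation is determined by its values on a window, here the one
    listed by w. *)
Lemma f_uw_unique f u w : is_affine n f ->
    (forall a, f (letter (w a)) = letter (u a) + (a < k)%N%:Z * N) ->
  f = f_uw k u w.
Proof.
move=> aff fE; apply/funext=> p; have [a [m ->]] := int_letter p.
rewrite -(permKV w a) f_uwE (affine_shift n_gt0 _ _ aff) fE; lia.
Qed.

Lemma f_uw_young u w z : in_young k z ->
  f_uw k (pmul u z) (pmul w z) = f_uw k u w.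
Proof.
move/in_youngP=> zk; apply/esym/f_uw_unique => [|a]; first exact: f_uw_affine.
by rewrite !pmulE f_uwE0 zk.
Qed.

Lemma f_uw_related u w (q' : 'S_n * 'S_n) : young_related k (u, w) q' ->
  f_uw k u w = f_uw k q'.1 q'.2.
Proof. by case=> z zk -> /=; rewrite f_uw_young. Qed.

(** The permutation w^-1 w' preserves the blocks because the positions below k
    are those at which f(w a) exceeds n. *)
Lemma f_uw_inj u w u' w' : f_uw k u w = f_uw k u' w' ->
  young_related k (u, w) (u', w').
Proof.
move=> E; pose z := pmul (w^-1)%g w'.
have wz a : w (z a) = w' a by rewrite /z pmulE permKV.
have both a : u (z a) = u' a /\ (z a < k)%N%:Z = (a < k)%N%:Z :> int.
  by apply: letter_shift_inj; have := f_uwE0 u w (z a); rewrite wz E f_uwE0.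
exists z.
  by apply/in_youngP=> a; have := (both a).2; do 2!case: (_ < k)%N.
by congr pair; apply/permP=> a /=; rewrite pmulE ?wz // (both a).1.
Qed.

Lemma f_uw_BoundP u w : Bound n k (f_uw k u w) <->
  (forall i, (i < k)%N -> (u i <= w i)%N) /\
  (forall i, (k <= i)%N -> (w i <= u i)%N).
Proof.
split=> [[_ bnd]|[up down]].
  split=> i ik; have := bnd (letter (w i)); rewrite f_uwE0 /letter.
    by rewrite ik; lia.
  by rewrite ltnNge ik; lia.
split; first exact: f_uw_deg.
move=> p; have [a [m ->]] := int_letter p; rewrite -(permKV w a) f_uwE.
move: ((w^-1)%g a) => {}a; have := letter_bounds (u a); have := letter_bounds (w a).
have := up a; have := down a; rewrite /letter mulrDl.
by case: ltnP => _ /=; lia.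
Qed.

Lemma k_dominated_Bound u w : k_dominated k u w -> Bound n k (f_uw k u w).
Proof. by case=> up down _; apply/f_uw_BoundP. Qed.

Lemma Bound_k_dominated u w : Bound n k (f_uw k u w) ->
  block_increasing k w \/ block_decreasing k u -> k_dominated k u w.
Proof.
move=> /f_uw_BoundP[up down] mono; split=> // a b blk ab uab.
case: mono => [inc|dec]; first exact: inc.
by have := dec a b blk ab; lia.
Qed.

(** Swapping positions of w permutes the arguments of f. *)
Lemma f_uw_swap_right u w i j : i != j ->
  f_uw k u (pmul w (tperm i j)) =
  f_uw k u w \o aswap n (letter (w i)) (letter (w j)).
Proof.
move=> nij; have npq : ~~ congr_mod n (letter (w i)) (letter (w j)).
  by rewrite letter_inj // (inj_eq perm_inj).
apply/esym/f_uw_unique => [|a /=].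
  by apply: affine_comp; [exact: f_uw_affine | exact: affine_aswap].
rewrite pmulE; have -> : aswap n (letter (w i)) (letter (w j))
    (letter (w (tperm i j a))) = letter (w a).
  case: tpermP => [->|->|/eqP ai /eqP aj]; rewrite ?aswapL ?aswapR //.
  by rewrite aswapD // letter_inj // (inj_eq perm_inj).
exact: f_uwE0.
Qed.

(** Swapping values of u is a reflection on the left, moved to the right through
    the preimages of u i and u j under f; these are w i and w j, pulled back by n
    for indices below k. *)
Lemma f_uw_swap_left u w i j : i != j ->
  f_uw k (pmul u (tperm i j)) w =
  f_uw k u w \o aswap n (letter (w i) - (i < k)%N%:Z * N)
                        (letter (w j) - (j < k)%N%:Z * N).
Proof.
move=> nij; have aff := f_uw_affine u w.
have fE a : f_uw k u w (letter (w a) - (a < k)%N%:Z * N) = letter (u a).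
  by rewrite -mulNr f_uwE addNr mul0r addr0.
have npq : ~~ congr_mod n (letter (u i)) (letter (u j)).
  by rewrite letter_inj // (inj_eq perm_inj).
rewrite aswap_comp // ?fE; last by rewrite -(affine_congr n_gt0 _ _ aff) !fE.
apply/esym/f_uw_unique => [|a].
  by apply: affine_comp; [exact: affine_aswap | exact: aff].
rewrite /= f_uwE0 aswap_shift //; congr (_ + _); rewrite pmulE.
case: tpermP => [->|->|/eqP ai /eqP aj]; rewrite ?aswapL ?aswapR //.
by rewrite aswapD // letter_inj // (inj_eq perm_inj).
Qed.

Lemma affine_up_bruhat f g : affine_up n k f g -> affine_bruhat_le n k f g.
Proof. by move=> up; apply/affine_bruhatP/Relation_Operators.rt_step. Qed.

(** Since w is increasing on blocks, and preimages of the first block are pulled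
    back by n, the preimages of u i and u j are in the order of i and j. *)
Lemma f_uw_mono_left u u' w : block_increasing k w -> bruhat_le u u' ->
  affine_bruhat_le n k (f_uw k u w) (f_uw k u' w).
Proof.
move=> inc; elim/bruhat_le_ind: u u' / => [u|u i j u' ij uij _].
  exact: Relation_Operators.rt_refl.
apply: Relation_Operators.rt_trans; apply: affine_up_bruhat.
have nij : i != j by rewrite neq_ltn ij.
split; first exact: f_uw_deg.
exists (letter (w i) - (i < k)%N%:Z * N), (letter (w j) - (j < k)%N%:Z * N).
split.
- have := letter_bounds (w i); have := letter_bounds (w j).
  have := inc i j; rewrite /same_block /letter.
  by case: (ltnP i k); case: (ltnP j k) => /=; lia.
- rewrite -mulNr -mulNr congr_shift congr_sym congr_shift letter_inj //.
  by rewrite (inj_eq perm_inj) eq_sym.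
- by rewrite -!mulNr !f_uwE !addNr !mul0r !addr0 letter_lt.
exact: f_uw_swap_left.
Qed.

(** If u is decreasing on blocks, i < j gives f(w i) > f(w j) whatever w is, so
    every step down of w is a step up of f.  In general an ascent of u in a block
    is also one of w and of w', and translating all three by it keeps f. *)
Lemma f_uw_anti_right u w w' : ascents_kept k u w -> ascents_kept k u w' ->
  bruhat_le w' w -> affine_bruhat_le n k (f_uw k u w) (f_uw k u w').
Proof.
elim/(@block_decreasing_ind n k): u w w' => [u dec|u i j sij uij IHu] w w'.
  move=> _ _; elim/bruhat_le_ind: w' w / => [w|w' i j w ij w'ij _ IHw].
    exact: Relation_Operators.rt_refl.
  apply: Relation_Operators.rt_trans IHw _; apply: affine_up_bruhat.
  have nij : i != j by rewrite neq_ltn ij.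
  split; first exact: f_uw_deg.
  exists (letter (w' i)), (letter (w' j)); split.
  - by rewrite letter_lt.
  - by rewrite letter_inj // (inj_eq perm_inj).
  - have <- : pmul w' (tperm i j) j = w' i by rewrite pmulE tpermR.
    have <- : pmul w' (tperm i j) i = w' j by rewrite pmulE tpermL.
    rewrite !f_uwE0; have := letter_bounds (u i); have := letter_bounds (u j).
    have := dec i j; rewrite /same_block /letter.
    by case: (ltnP i k); case: (ltnP j k) => /=; lia.
  rewrite -{1}(pmul_tpermK i j w') f_uw_swap_right // !pmulE tpermL tpermR.
  rewrite aswapC // letter_inj // (inj_eq perm_inj) eq_sym //.
move=> asc asc'; have [jS ij blk] := block_simpleE sij.
have wij := asc i j blk ij uij; have wij' := asc' i j blk ij uij.
move=> /(raise_mono jS); rewrite /raise wij wij' => le_s.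
rewrite -(f_uw_young u w (block_simple_young sij)).
rewrite -(f_uw_young u w' (block_simple_young sij)).
by apply: IHu => //; apply: ascents_kept_move; rewrite ?uij.
Qed.

(** For the sorted top y the step from x to x' is covered by [f_uw_mono_left], and
    any ascent of x' inside a block is trivially one of y, so [f_uw_anti_right]
    covers the step from y to y'. *)
Lemma nested_affine u w (q : 'S_n * 'S_n) :
  k_dominated k u w -> nested k (u, w) q ->
  affine_bruhat_le n k (f_uw k u w) (f_uw k q.1 q.2).
Proof.
move=> dom nest.
have [[x y] [[x' y'] [/= _ inc rel [/= [_ _ asc] xx' y'y] rel']]] :=
  nested_to_increasing dom nest.
rewrite (f_uw_related rel) /=; move: rel'; case: q {nest} => x1 y1 rel'.
rewrite (f_uw_related rel') /=.
apply: Relation_Operators.rt_trans (f_uw_mono_left inc xx') _.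
by apply: f_uw_anti_right => // a b blk ab _; exact: inc.
Qed.


(** * From affine Bruhat order back to intervals *)

(** For p < q and f(p) < f(q) the bounds on g give
    q <= f(p) < f(q) <= p + n, which is stronger than the bounds on f. *)
Lemma affine_up_Bound f g : affine_up n k f g -> Bound n k g -> Bound n k f.
Proof.
move=> [deg [p [q [pq npq fpq def_g]]]] [_ bnd]; split=> // x.
have aff := deg.1; have gp : g p = f q by rewrite def_g /= aswapL.
have gq : g q = f p by rewrite def_g /= aswapR.
have := bnd p; have := bnd q; rewrite gp gq => bq bp.
have [/congr_modP[m ->]|nxp] := boolP (congr_mod n x p).
  by rewrite (affine_shift n_gt0 _ _ aff); lia.
have [/congr_modP[m ->]|nxq] := boolP (congr_mod n x q).
  by rewrite (affine_shift n_gt0 _ _ aff); lia.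
by have := bnd x; rewrite def_g /= aswapD.
Qed.

Lemma affine_bruhat_Bound f g :
  Relation_Operators.clos_refl_trans _ (affine_up n k) f g ->
  Bound n k g -> Bound n k f.
Proof.
elim=> [{}f {}g|//|f1 f2 f3 _ IH1 _ IH2 bnd]; first exact: affine_up_Bound.
exact/IH1/IH2.
Qed.

(** List the elements of J first and those of its complement afterwards. *)
Lemma exists_sigma (J : {set 'I_n}) : #|J| = k ->
  exists w : 'S_n, sigma k w = J.
Proof.
move=> cardJ; pose s := enum J ++ enum (~: J).
have size_s : size s = n.
  by rewrite size_cat -!cardE cardsC card_ord.
have uniq_s : uniq s.
  rewrite cat_uniq !enum_uniq andbT /=; apply/hasPn => a.
  by rewrite !mem_enum inE.
have nth_inj : injective (fun a : 'I_n => nth a s a).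
  move=> a b /eqP; rewrite (set_nth_default a b) ?size_s // nth_uniq ?size_s //.
  by move/eqP/val_inj.
exists (perm nth_inj); apply/eqP; rewrite eqEcard cardJ; apply/andP; split.
  apply/fintype.subsetP => x /imsetP[a]; rewrite inE => ak ->; rewrite permE.
  rewrite nth_cat -cardE cardJ ak -mem_enum; apply: mem_nth.
  by rewrite -cardE cardJ.
rewrite /sigma card_imset; last exact: perm_inj.
by rewrite -{1}card_ord_lt; apply: eq_leq; apply: eq_card => a; rewrite !inE.
Qed.

Lemma sigma_increasing (w : 'S_n) :
  exists2 w' : 'S_n, sigma k w' = sigma k w & block_increasing k w'.
Proof.
elim/(@block_increasing_ind n k): w => [w inc|w i j sij _ [w' sig inc]].
  by exists w.
by exists w' => //; rewrite sig sigma_young //; exact: block_simple_young.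
Qed.

(** On 1, ..., n a bounded f takes values in [1, 2n], hence is a permutation pi
    plus n on the set J where it exceeds n; the degree of f gives #|J| = k.  Take
    w with first k values J and u = pi w. *)
Lemma Bound_exists f : Bound n k f ->
  exists u w : 'S_n, [/\ k_dominated k u w, block_increasing k w & f = f_uw k u w].
Proof.
move=> bf; have [/affine_degP[aff deg] bnd] := bf.
have [s sE] := choice (fun a => letter_exists n_gt0 (f (letter a))).
pose J := [set a : 'I_n | N < f (letter a)].
have fE a : f (letter a) = letter (s a) + (a \in J)%:Z * N.
  have /congr_modP[m E] := sE a; rewrite E; congr (_ + _ * _).
  have := bnd (letter a); rewrite inE E.
  have := letter_bounds a; have := letter_bounds (s a) => b1 b2 b3.
  have [m_lt|[m_ge|[->|->]]] : m <= -1 \/ 2%:Z <= m \/ m = 0 \/ m = 1 by lia.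
  - have : m * N <= -1 * N by rewrite ler_wpM2r.
    by lia.
  - have : 2%:Z * N <= m * N by rewrite ler_wpM2r.
    by lia.
  - by case: ltP; lia.
  by case: ltP; lia.
have s_inj : injective s.
  move=> a b E; apply/eqP.
  rewrite -(letter_inj n_gt0) -(affine_congr n_gt0 _ _ aff).
  by rewrite !fE E congr_shift congr_sym congr_shift congr_refl.
have cardJ : #|J| = k.
  move: deg; rewrite /adeg (eq_bigr (fun a => letter (perm s_inj a) - letter a +
      (if a \in J then N else 0))); last first.
    by move=> a _; rewrite fE permE; case: (a \in J) => /=; lia.
  rewrite big_split /= sumrB -big_mkcond /= sumr_const.
  rewrite -(reindex_inj (h := perm s_inj) (P := xpredT) (F := @letter n));
    last exact: perm_inj.
  rewrite subrr add0r -mulr_natl natz -PoszM => -[/eqP].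
  by rewrite mulnC eqn_pmul2l // => /eqP.
have [w0 sig0] := exists_sigma cardJ; have [w sig inc] := sigma_increasing w0.
have def_f : f = f_uw k (pmul (perm s_inj) w) w.
  apply: f_uw_unique => // a.
  by rewrite fE pmulE permE -sig0 -sig mem_sigma.
exists (pmul (perm s_inj) w), w; split=> //.
by apply: Bound_k_dominated; [rewrite -def_f | left].
Qed.

Lemma related_decreasing (u w : 'S_n) : k_dominated k u w ->
  exists x y : 'S_n,
    [/\ k_dominated k x y, block_decreasing k x & young_related k (u, w) (x, y)].
Proof.
elim/(@block_decreasing_ind n k): u w => [u dec|u i j sij uij IHu] w dom.
  by exists u, w; split=> //; exact: young_related_refl.
have [x [y [dom' dec rel]]] := IHu _ (k_dominated_raise sij dom uij).
exists x, y; split=> //; apply: young_related_trans rel.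
exact: young_related_simple.
Qed.

Lemma related_increasing (u w : 'S_n) : k_dominated k u w ->
  exists x y : 'S_n,
    [/\ k_dominated k x y, block_increasing k y & young_related k (u, w) (x, y)].
Proof.
move=> dom; have [x [y [dom' inc eq_xy]]] := Q_equiv_increasing dom.
exists x, y; split=> //.
by have [] := Q_equiv_related eq_xy (proj2 (k_bruhatP _ _ _) dom).
Qed.

Lemma nested_self (u w : 'S_n) : k_dominated k u w -> nested k (u, w) (u, w).
Proof. by move=> dom; split=> //; exact: bruhat_refl. Qed.

Lemma affine_up_nested (u w u' w' : 'S_n) :
    k_dominated k u w -> k_dominated k u' w' ->
    affine_up n k (f_uw k u w) (f_uw k u' w') ->
  exists2 q : 'S_n * 'S_n, nested k (u, w) q & young_related k (u', w') q.
Proof.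
move=> dom dom' [_ [p0 [q0 [pq0 npq0 fpq0 def_g]]]].
have [a [m def_p0]] := int_letter p0; have [b [m' def_q0]] := int_letter q0.
pose p := letter a; pose q := letter b + (m' - m) * N.
have swap_pq : aswap n p0 q0 = aswap n p q.
  rewrite -(aswap_translate n_gt0 p q m) def_p0; congr aswap.
  by rewrite def_q0 /q; lia.
have pq : p < q by move: pq0; rewrite def_p0 def_q0 /p /q; lia.
have nab : a != b.
  rewrite -(letter_inj n_gt0); move: npq0; rewrite def_p0 def_q0.
  by rewrite congr_shift congr_sym congr_shift congr_sym.
have npq : ~~ congr_mod n p q.
  by rewrite congr_sym congr_shift congr_sym letter_inj.
have aff := f_uw_affine u w; set f := f_uw k u w in fpq0 def_g aff *.
rewrite swap_pq in def_g; set g := f_uw k u' w' in def_g.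
have fpq : f p < f q.
  move: fpq0; rewrite def_p0 def_q0.
  have -> : letter b + m' * N = q + m * N by rewrite /q; lia.
  by rewrite !(affine_shift n_gt0 _ _ aff) -/p; lia.
have gpq : g q < g p by rewrite def_g /= aswapL ?aswapR.
have def_f : f = g \o aswap n p q.
  by rewrite def_g; apply/funext=> x /=; rewrite aswapK.
have bnd := k_dominated_Bound dom; have bnd' := k_dominated_Bound dom'.
have := bnd'.2 p; have := bnd'.2 q; rewrite -/g => bq bp.
have bb := letter_bounds b; have ba := letter_bounds a.
(* The representatives x, y of f and r of g may be chosen freely, since the
   containment can be transported to (u, w). *)
suff [x [y [r [domr nest gr relf]]]] : exists (x y : 'S_n) (r : 'S_n * 'S_n),
    [/\ k_dominated k x y, nested k (x, y) r,
        young_related k (u', w') r & f = f_uw k x y].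
  have rel := young_related_sym (f_uw_inj relf).
  have [r' nest' rel'] := @nested_transport _ _ (x, y) (u, w) r domr dom rel nest.
  by exists r' => //; exact: young_related_trans gr rel'.
(* From p < q <= g q < g p <= p + n. *)
have [cE|cE] : m' - m = 0 \/ m' - m = 1.
  have [c_le|[c_ge|//]] : m' - m <= -1 \/ 2%:Z <= m' - m \/
      m' - m = 0 \/ m' - m = 1 by lia.
    have : (m' - m) * N <= -1 * N by rewrite ler_wpM2r.
    by move: pq; rewrite /p /q; lia.
  have : 2%:Z * N <= (m' - m) * N by rewrite ler_wpM2r.
  by move: bq bp gpq; rewrite /p /q; lia.
(* Within a window f is obtained by exchanging two values of y. *)
- have [x [y [domxy dec rel]]] := related_decreasing dom'.
  have gE := f_uw_related rel; rewrite -/g /= in gE.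
  pose i := (y^-1)%g a; pose j := (y^-1)%g b.
  have yi : y i = a by rewrite permKV.
  have yj : y j = b by rewrite permKV.
  have nij : i != j by rewrite (inj_eq perm_inj).
  have def_q : q = letter b by rewrite /q cE mul0r addr0.
  have ij : (i < j)%N.
    rewrite ltn_neqAle (inj_eq val_inj) nij leqNgt; apply/negP=> ji.
    move: gpq; rewrite def_q /p -yi -yj gE !f_uwE0.
    have := dec j i; rewrite /same_block /letter.
    have := letter_bounds (x i); have := letter_bounds (x j); rewrite /letter.
    by case: (ltnP i k); case: (ltnP j k) => /=; lia.
  have yij : (y i < y j)%N by move: pq; rewrite def_q /p letter_lt yi yj.
  exists x, (pmul y (tperm i j)), (x, y).
  have fE : f = f_uw k x (pmul y (tperm i j)).
    by rewrite f_uw_swap_right // yi yj -gE def_f def_q.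
  split=> //; first by apply: Bound_k_dominated; [rewrite -fE | right].
  by split=> //=; [exact: bruhat_refl | exact: bruhat_swap].
(* Across the window boundary g winds at a but not at b, so f is obtained by
   exchanging a value of x in the first block with one in the second. *)
have [x [y [domxy inc rel]]] := related_increasing dom'.
have gE := f_uw_related rel; rewrite -/g /= in gE.
pose i := (y^-1)%g a; pose j := (y^-1)%g b.
have yi : y i = a by rewrite permKV.
have yj : y j = b by rewrite permKV.
have nij : i != j by rewrite (inj_eq perm_inj).
have def_q : q = letter b + 1 * N by rewrite /q cE.
have [ik [kj xji]] : (i < k)%N /\ (k <= j)%N /\ (x j < x i)%N.
  move: gpq; rewrite def_q /p -yi -yj gE f_uwE f_uwE0.
  have := letter_bounds (x i); have := letter_bounds (x j); rewrite /letter.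
  by case: (ltnP i k); case: (ltnP j k) => /=; lia.
have ij := leq_trans ik kj.
exists (pmul x (tperm i j)), y, (x, y).
have fE : f = f_uw k (pmul x (tperm i j)) y.
  rewrite f_uw_swap_left // yi yj -gE def_f ik ltnNge kj /= mul0r subr0 def_q.
  rewrite -(aswap_translate n_gt0 (letter a - 1 * N) _ 1).
  by rewrite subrK.
split=> //; first by apply: Bound_k_dominated; [rewrite -fE | left].
split=> //=; last exact: bruhat_refl.
rewrite -{2}(pmul_tpermK i j x); apply: bruhat_swap => //.
by rewrite !pmulE tpermL tpermR.
Qed.

(** The middle element of a chain is bounded, hence comes from some pair, and
    the containments compose after transporting the second one. *)
Lemma affine_nested (u w u' w' : 'S_n) :
    k_dominated k u w -> k_dominated k u' w' ->
    affine_bruhat_le n k (f_uw k u w) (f_uw k u' w') ->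
  exists2 q : 'S_n * 'S_n, nested k (u, w) q & young_related k (u', w') q.
Proof.
move=> dom dom' /(affine_bruhatP n_gt0).
move def_f: (f_uw k u w) => f; move def_g: (f_uw k u' w') => g le_fg.
elim: le_fg u w u' w' dom dom' def_f def_g => {f g}
  [f g up|f|f h g _ IH1 hg IH2] u w u' w' dom dom' def_f def_g.
- by apply: affine_up_nested => //; rewrite def_f def_g.
- exists (u, w); first exact: nested_self.
  by apply: f_uw_inj; rewrite def_f def_g.
have bnd_g : Bound n k g by rewrite -def_g; exact: k_dominated_Bound.
have [x [y [domxy _ def_h]]] := Bound_exists (affine_bruhat_Bound hg bnd_g).
have [q1 nest1 rel1] := IH1 _ _ _ _ dom domxy def_f (esym def_h).
have [q2 nest2 rel2] := IH2 _ _ _ _ domxy dom' (esym def_h) def_g.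
have [domq1 le1 le1'] := nest1.
have [q3 [domq3 le3 le3'] rel3] :=
  @nested_transport _ _ (x, y) q1 q2 domxy domq1 rel1 nest2.
exists q3; last exact: young_related_trans rel2 rel3.
by split=> //; [exact: bruhat_trans le1 le3 | exact: bruhat_trans le3' le1'].
Qed.


(** * Counting the inversions of a bounded affine permutation *)

(** The pair is an inversion of f at w a and at the first integer after it that
    is congruent to w b. *)
Definition inversion_pair u w a b : bool :=
  letter (u b) + ((w b < w a)%N%:Z + (b < k)%N%:Z) * N <
  letter (u a) + (a < k)%N%:Z * N.

Lemma sum_straddle :
  (\sum_(x : 'I_n * 'I_n) ((x.1 < k) && (k <= x.2)) = k * (n - k))%N.
Proof.
have low : (\sum_(a < n) (a < k)%N = k)%N.
  by rewrite -[RHS]card_ord_lt -sum1_card [RHS]big_mkcond; apply: eq_bigr => a _;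
    rewrite inE; case: (_ < _)%N.
have high : (\sum_(a < n) (k <= a)%N = n - k)%N.
  apply/eqP; rewrite -(eqn_add2l k) subnKC // -{1}low -big_split /=.
  rewrite (eq_bigr (fun=> 1%N)) ?sum1_card ?card_ord // => a _.
  by case: ltnP.
rewrite -[in RHS]high -[in X in (X * _)%N]low big_distrlr /= pair_bigA /=.
by apply: eq_bigr => x _; rewrite mulnb.
Qed.

(** The identity holds for each ordered pair (a, b) separately.  If a < k <= b it
    reads 1 - [w b < w a] + [u b < u a], as u b < u a forces w b < w a.  In the
    same block with a < b it reads [u b < u a] - [w b < w a], as w b < w a forces
    u b < u a.  In the remaining cases there is no inversion. *)
Lemma sum_inversion_pair u w : k_dominated k u w ->
  ((\sum_(x : 'I_n * 'I_n) inversion_pair u w x.1 x.2) + plength w =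
   k * (n - k) + plength u)%N.
Proof.
have plengthE v : plength v =
    (\sum_(x : 'I_n * 'I_n) ((x.1 < x.2) && (v x.2 < v x.1)))%N.
  by rewrite /plength -sum1_card big_mkcond; apply: eq_bigr => x _;
    rewrite inE; case: (_ && _).
case=> up down asc; rewrite -sum_straddle !plengthE -!big_split /=.
apply: eq_bigr => -[a b] _ /=.
have := letter_bounds (u a); have := letter_bounds (u b).
have [->|nab] := eqVneq a b; first by rewrite /inversion_pair; lia.
have := perm_neq u nab; have := perm_neq w nab; move: nab.
rewrite -!(inj_eq val_inj) /= => nab nwab nuab.
have := asc a b; have := asc b a; have := up a; have := up b.
have := down a; have := down b.
rewrite /inversion_pair /same_block /letter.
by case: (ltnP a k); case: (ltnP b k); case: (ltngtP (w b) (w a)) nwab => //=; lia.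
Qed.

(** As f is bounded, only the first representative of w b after w a can form an
    inversion with it. *)
Definition inversion_class w (x : 'I_n * 'I_n) : set (int * int) :=
  translates n (letter (w x.1), letter (w x.2) + (w x.2 < w x.1)%N%:Z * N).

Lemma translates_shift p q m :
  translates n (p + m * N, q + m * N) = translates n (p, q).
Proof.
apply/seteqP; split=> -[x y] [r /= [-> ->]].
  by exists (r + m) => /=; congr pair; lia.
by exists (r - m) => /=; congr pair; lia.
Qed.

Lemma inversion_class_inj w : injective (inversion_class w).
Proof.
move=> [a b] [c d] E.
have : inversion_class w (a, b) (letter (w a), letter (w b) + (w b < w a)%N%:Z * N).
  by exists 0; rewrite /= !mul0r !addr0.
rewrite E => -[m /= [Ea Eb]].
have [/perm_inj-> _] : w a = w c /\ 0 = m.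
  by apply: letter_shift_inj; rewrite mul0r addr0.
have [/perm_inj-> _] : w b = w d /\ (w b < w a)%N%:Z = (w d < w c)%N%:Z + m :> int.
  by apply: letter_shift_inj; rewrite Eb; lia.
by [].
Qed.

Lemma affine_inversionsE u w : k_dominated k u w ->
  affine_inversions n (f_uw k u w) =
  (inversion_class w @` [set x | inversion_pair u w x.1 x.2])%classic.
Proof.
move=> dom; have [_ bnd] := k_dominated_Bound dom; apply/seteqP; split=> [C|C].
  case=> p [q [pq fqp ->]].
  have [a' [m def_p]] := int_letter p; have [b' [m' def_q]] := int_letter q.
  pose a := (w^-1)%g a'; pose b := (w^-1)%g b'.
  have wa : w a = a' by rewrite permKV.
  have wb : w b = b' by rewrite permKV.
  have mE : m' - m = (w b < w a)%N%:Z.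
    have := bnd p; have := bnd q.
    have := letter_bounds a'; have := letter_bounds b'.
    rewrite wa wb -letter_lt.
    move: pq fqp; rewrite def_p def_q => pq fqp ba bb bq bp.
    have c_lt : (m' - m) * N < 2%:Z * N by lia.
    have c_gt : - 1 * N < (m' - m) * N by lia.
    move: c_lt c_gt; rewrite !ltr_pM2r // => c_lt c_gt.
    have [E|E] : m' - m = 0 \/ m' - m = 1 by lia.
      have Em : m' = m by lia.
      by rewrite E; move: pq; rewrite Em; case: ltP; lia.
    have Em : m' = m + 1 by lia.
    by rewrite E; move: bq bp fqp; rewrite Em; case: ltP; lia.
  exists (a, b); last first.
    rewrite /inversion_class /= wa wb -(translates_shift _ _ m) def_p def_q.
    by rewrite -wa -wb -mE; congr (translates _ (_, _)); lia.
  move: fqp; rewrite /inversion_pair /= def_p def_q -wa -wb !f_uwE.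
  by rewrite -mE; lia.
case=> -[a b] /= inv <-.
exists (letter (w a)), (letter (w b) + (w b < w a)%N%:Z * N); split=> //.
  have := letter_bounds (w a); have := letter_bounds (w b).
  move: inv; rewrite /inversion_pair /letter.
  have [->|nab] := eqVneq a b; first by rewrite ltnn /=; lia.
  have := perm_neq w nab; rewrite -(inj_eq val_inj) /=.
  by case: ltngtP => //=; lia.
by rewrite f_uwE0 f_uwE.
Qed.

Lemma affine_length_f_uw u w : k_dominated k u w ->
  affine_length n (f_uw k u w)
    (\sum_(x : 'I_n * 'I_n) inversion_pair u w x.1 x.2)%N.
Proof.
move=> dom; pose E := [set x : 'I_n * 'I_n | inversion_pair u w x.1 x.2].
have -> : (\sum_(x : 'I_n * 'I_n) inversion_pair u w x.1 x.2 = #|E|)%N.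
  rewrite -sum1_card [RHS]big_mkcond; apply: eq_bigr => x _.
  by rewrite inE; case: (inversion_pair _ _ _ _).
pose F (i : 'I_#|E|) := inversion_class w (enum_val i).
rewrite /affine_length; have -> : affine_inversions n (f_uw k u w) = range F.
  rewrite (affine_inversionsE dom); apply/seteqP; split=> [C [x xE <-]|C [i _ <-]].
    have xE' : x \in E by rewrite inE.
    by exists (enum_rank_in xE' x) => //; rewrite /F enum_rankK_in.
  by exists (enum_val i) => //=; have := enum_valP i; rewrite inE.
apply: (card_eq_trans _ (card_esym card_II)); apply: inj_card_eq => i j _ _.
by move=> /inversion_class_inj/enum_val_inj.
Qed.

End BoundedAffine.

(** * The isomorphism *)

Lemma Q_class_eq (n k : nat) (u w u' w' : 'S_n) : k_dominated k u w ->
  k_dominated k u' w' -> young_related k (u, w) (u', w') ->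
  Q_class k u w = Q_class k u' w'.
Proof.
move=> dom dom' rel; apply/setP=> p.
have rel' := young_related_sym rel.
by apply/(Q_class_memP _ dom)/(Q_class_memP _ dom') => -[domp relp];
  split=> //; [exact: young_related_trans rel' relp
             | exact: young_related_trans rel relp].
Qed.

Theorem theorem3p16 (n k : nat) (n_gt0 : (0 < n)%N) (le_kn : (k <= n)%N) :
  (exists F : {set 'S_n * 'S_n} -> (int -> int),
     (forall u w : 'S_n, k_bruhat_le k u w -> F (Q_class k u w) = f_uw k u w) /\
     poset_iso (fun q => q \in Q_poset n k) (@Q_le n)
               (Bound n k) (affine_bruhat_le n k) F) /\
  (forall u w : 'S_n, k_bruhat_le k u w ->
     exists2 m : nat, affine_length n (f_uw k u w) m &
       (m%:Z = (k * (n - k))%:Z - (plength w)%:Z + (plength u)%:Z)%R).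
Proof.
split; last first.
  move=> u w /k_bruhatP dom.
  exists (\sum_(x : 'I_n * 'I_n) inversion_pair k u w x.1 x.2).
    exact: affine_length_f_uw.
  by have := sum_inversion_pair n_gt0 le_kn dom; lia.
pose F (q : {set 'S_n * 'S_n}) : int -> int :=
  if [pick p in q] is Some p then f_uw k p.1 p.2 else id.
have FE (u w : 'S_n) : k_dominated k u w -> F (Q_class k u w) = f_uw k u w.
  move=> dom; rewrite /F; case: pickP => [p|/(_ (u, w))].
    by case/(Q_class_memP _ dom) => _ rel; rewrite (f_uw_related n_gt0 le_kn rel).
  by case/(Q_class_memP _ dom); split=> //; exact: young_related_refl.
have Q_posetP q : q \in Q_poset n k ->
    exists u w : 'S_n, k_dominated k u w /\ q = Q_class k u w.
  by case/imsetP=> -[u w]; rewrite inE /= => /k_bruhatP dom ->; exists u, w.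
have in_Q (u w : 'S_n) : k_dominated k u w -> Q_class k u w \in Q_poset n k.
  by move=> dom; apply/imsetP; exists (u, w) => //; rewrite inE; apply/k_bruhatP.
have F_Bound q : q \in Q_poset n k -> Bound n k (F q).
  by case/Q_posetP=> u [w [dom ->]]; rewrite FE //; exact: k_dominated_Bound.
have F_inj q q' : q \in Q_poset n k -> q' \in Q_poset n k -> F q = F q' -> q = q'.
  case/Q_posetP=> u [w [dom ->]] /Q_posetP[u' [w' [dom' ->]]].
  rewrite !FE // => /(f_uw_inj n_gt0 le_kn) rel; exact: Q_class_eq.
have F_le q q' : q \in Q_poset n k -> q' \in Q_poset n k ->
    Q_le q q' <-> affine_bruhat_le n k (F q) (F q').
  case/Q_posetP=> u [w [dom ->]] /Q_posetP[u' [w' [dom' ->]]]; rewrite !FE //.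
  split=> [/(Q_leP dom dom')[p nest rel]|].
    by rewrite (f_uw_related n_gt0 le_kn rel); exact: nested_affine.
  by move/(affine_nested n_gt0 le_kn dom dom') => nest; apply/(Q_leP dom dom').
have [refl_B anti_B trans_B] := affine_bruhat_order n_gt0 k (Bound n k).
exists F; split=> [u w /k_bruhatP|]; first exact: FE.
split=> //.
- split=> [q qQ|q q' qQ qQ' le1 le2|q q' q'' qQ qQ' qQ'' le1 le2].
  + by apply/(F_le _ _ qQ qQ)/refl_B/F_Bound.
  + by apply: F_inj => //; apply: anti_B; do ?exact: F_Bound; apply/F_le.
  apply/(F_le _ _ qQ qQ''); apply: (trans_B _ (F q')); do ?exact: F_Bound.
    exact/F_le.
  exact/F_le.
split=> [q|q q' /set_mem qQ /set_mem qQ'|f]; first exact: F_Bound.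
  exact: F_inj.
move=> /(Bound_exists n_gt0 le_kn)[u [w [dom _ ->]]].
by exists (Q_class k u w); [exact: in_Q | rewrite FE].
Qed.
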